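(* Let $k,n$ be integers with $2\le k\le n$, let $r\ge0$ be an integer, and let $\Delta_{k,n}$ be a $\Delta_{k,n}$ split of an $n$-simplex in $\mathbb{R}^n$. Then $$\rho_{k,r}\le \operatorname{mos} S^r(\Delta_{k,n})\le \rho_{n,r},$$ where $\rho_{j,r}:=r+(j-1)\left\lfloor\frac{r+1}{2}\right\rfloor$ for $j\ge1$.
   Context: The split $\Delta_{k,n}$ ($1\le k\le n$): let $T$ be an $n$-simplex in $\mathbb{R}^n$. First, split each $k$-face $F$ of $T$ by choosing any point in the relative interior of $F$ and connecting it to the $(k-1)$-faces of $F$ (i.e. taking convex hulls). Then, for $j=k+1,\ldots,n$ in sequence, split each $j$-face $F$ of $T$ by choosing any point in the relative interior of $F$ and connecting it to the $(j+1)!/k!$ simplices of dimension $j-1$ that were constructed on the boundary of $F$ in the previous step. The result is a split of $T$ into $(n+1)!/k!$ $n$-simplices, which is a cell around the point $v$ in the interior of $T$ chosen in the last step ($j=n$; this is the initial step if $k=n$); it is denoted $\Delta_{k,n}$. All the chosen points are arbitrary. Let $\Delta_v$ be a cell around $v$ (a set of $n$-simplices of a simplicial mesh, all having $v$ as a vertex), here $\Delta_v=\Delta_{k,n}$. A spline on $\Delta_v$ is a family $\sigma=\{(U_T,f_T): T\in\Delta_v\}$ with, for each $T$, $U_T\subset\mathbb{R}^n$ open, $T\subset U_T$ and $f_T\in C^\infty(U_T)$ real-valued; $S(\Delta_v)$ is the set of all such splines. For a multi-index $\alpha$, $D^\alpha$ is the corresponding partial derivative, of order $|\alpha|$. For an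 integer $r\ge0$, $S^r(\Delta_v)$ is the set of $\sigma\in S(\Delta_v)$ such that $D^\alpha f_{T_1}|_F=D^\alpha f_{T_2}|_F$ for all $|\alpha|\le r$ and all $T_1,T_2\in\Delta_v$ such that $F=T_1\cap T_2$ is an $(n-1)$-face. For an integer $\rho\ge0$, $C^\rho(\Delta_v)$ is the set of $\sigma\in S(\Delta_v)$ such that $D^\alpha f_{T_1}(v)=D^\alpha f_{T_2}(v)$ for all $|\alpha|\le\rho$ and all $T_1,T_2\in\Delta_v$. The maximal order of supersmoothness is $\operatorname{mos} S^r(\Delta_v)=\max\{\rho\ge r: S^r(\Delta_v)\subset C^\rho(\Delta_v)\}$ ($\rho$ an integer). *)

(* Defs.v *)
From HB Require Import structures.
From mathcomp Require Import all_boot all_order all_algebra finmap.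
From mathcomp Require Import all_classical all_reals all_analysis.

Set Implicit Arguments.
Unset Strict Implicit.
Unset Printing Implicit Defensive.

Import Order.TTheory GRing.Theory Num.Theory.
Import numFieldNormedType.Exports.

Local Open Scope classical_set_scope.
Local Open Scope ring_scope.

Section Simplices.
Context {R : realType} {n : nat}.
Local Notation V := 'rV[R]_n.
Implicit Types (T F S : {fset V}) (x y v : V).

Definition conv_hull T : set V :=
  [set y | exists w : V -> R, [/\ forall x, x \in T -> 0 <= w x,
     \sum_(x <- T) w x = 1 & y = \sum_(x <- T) w x *: x]].

Definition aff_hull T : set V :=
  [set y | exists w : V -> R,
     \sum_(x <- T) w x = 1 /\ y = \sum_(x <- T) w x *: x].

Definition aff_indep T : Prop :=
  forall w : V -> R, \sum_(x <- T) w x = 0 -> \sum_(x <- T) w x *: x = 0 ->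
    forall x, x \in T -> w x = 0.

(* Interior of the convex hull relative to the affine hull. *)
Definition rel_interior T : set V :=
  [set x | conv_hull T x /\ \forall y \near x, aff_hull T y -> conv_hull T y].

(* A simplex is encoded by the finite set of its vertices: T stands for
   [conv_hull T], and the j-faces of T are the subsets of T with j + 1
   elements. *)
Definition is_simplex (j : nat) T : Prop := #|` T| = j.+1 /\ aff_indep T.

Definition is_face (j : nat) T (X : set V) : Prop :=
  exists F, [/\ (F `<=` T)%fset, #|` F| = j.+1 & X = conv_hull F].

(* [split_cells k c F] is the set of simplices into which the face F is split,
   c G being the point chosen in the face G.  The (j-1)-faces of a j-face F
   are the F minus x, for x a vertex of F. *)
Inductive split_cells (k : nat) (c : {fset V} -> V) :
    {fset V} -> {fset V} -> Prop :=
| split_first F x : #|` F| = k.+1 -> x \in F ->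
    split_cells k c F (c F |` (F `\ x))%fset
| split_next F x S : (k.+1 < #|` F|)%N -> x \in F ->
    split_cells k c (F `\ x)%fset S ->
    split_cells k c F (c F |` S)%fset.

(* Delta is a Delta_{k,n} split of some n-simplex, seen as a cell around v. *)
Definition is_Delta (k : nat) (Delta : set {fset V}) v : Prop :=
  exists T (c : {fset V} -> V),
    [/\ is_simplex n T,
        forall F, (F `<=` T)%fset -> (k < #|` F|)%N -> rel_interior F (c F),
        Delta = split_cells k c T & v = c T].

End Simplices.

Section Splines.
Context {R : realType} {n : nat}.
Local Notation V := 'rV[R]_n.
Implicit Types (f : V -> R) (Delta : set {fset V}) (v : V).

Definition pderive (i : 'I_n) f : V -> R := 'D_('e_i) f.

(* [pderives [:: i1; ...; im] f] is d/dx_i1 (... (d/dx_im f)). *)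
Definition pderives (s : seq 'I_n) f : V -> R := foldr pderive f s.

(* f is C^oo on the open set U: the iterated partial derivatives of all orders
   exist and are continuous on U. Values of f off U are irrelevant. *)
Definition smooth_on (U : set V) f : Prop :=
  forall (s : seq 'I_n) x, U x ->
    {for x, continuous (pderives s f)} /\
    forall i, derivable (pderives s f) x 'e_i.

Definition mi_order (a : {ffun 'I_n -> nat}) : nat := \sum_i a i.

Definition mi_derive (a : {ffun 'I_n -> nat}) f : V -> R :=
  pderives (flatten [seq nseq (a i) i | i <- enum 'I_n]) f.

(* A spline assigns to T the pair (U_T, f_T); it is only constrained, and only
   used, at the simplices T of Delta. *)
Definition spline_family : Type := {fset V} -> set V * (V -> R).

Definition spline Delta : set spline_family :=
  [set sigma | forall T, Delta T ->
     [/\ open (sigma T).1, conv_hull T `<=` (sigma T).1 &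
         smooth_on (sigma T).1 (sigma T).2]].

Definition spline_smooth (r : nat) Delta : set spline_family :=
  [set sigma | spline Delta sigma /\
     forall T1 T2, Delta T1 -> Delta T2 ->
       is_face n.-1 T1 (conv_hull T1 `&` conv_hull T2) ->
       is_face n.-1 T2 (conv_hull T1 `&` conv_hull T2) ->
       forall a, (mi_order a <= r)%N ->
       forall x, (conv_hull T1 `&` conv_hull T2) x ->
         mi_derive a (sigma T1).2 x = mi_derive a (sigma T2).2 x].

Definition spline_smooth_at (rho : nat) Delta v : set spline_family :=
  [set sigma | spline Delta sigma /\
     forall T1 T2, Delta T1 -> Delta T2 ->
       forall a, (mi_order a <= rho)%N ->
         mi_derive a (sigma T1).2 v = mi_derive a (sigma T2).2 v].

(* m is the maximum of {rho >= r | S^r(Delta) is contained in C^rho(Delta)};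
   in particular this maximum exists. *)
Definition is_mos (r : nat) Delta v (m : nat) : Prop :=
  let P rho := (r <= rho)%N /\
    spline_smooth r Delta `<=` spline_smooth_at rho Delta v in
  P m /\ forall rho, P rho -> (rho <= m)%N.

End Splines.

Definition rho (j r : nat) : nat := (r + (j - 1) * (r.+1 %/ 2))%N.

(* Main.v *)
Require Import Defs.
From mathcomp Require Import all_boot all_order all_algebra finmap.
From mathcomp Require Import all_classical all_reals all_analysis.
From mathcomp Require Import perm.
From mathcomp Require Import ring lra zify.

(** The derivatives of a spline [sigma] at the centre [v] enter only through
    the Taylor forms of its pieces, and the condition on the facets through [v]
    says that, for adjacent cells, the difference of these forms vanishes to
    order [r] along the hyperplane spanned by the common facet ([facet_jets]).
    All pieces agree at [v] up to order [d] as soon as such a compatible family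
    of forms of degree [d] is constant.

    The decisive case is a simplex with [N + 1] vertices coned from an interior
    point. In barycentric coordinates, divided by the weights of that point,
    the walls are the hyperplanes [x_i = x_k], and with [m = r + 1] a family
    [p_i] is compatible when [(x_i - x_k)^m] divides [p_i - p_k]. The integrals
    from [0] to [x_i] of the products of the [(t - x_l)^(a l)] over all [l]
    form compatible families as soon as [a i + a k + 1 >= m] whenever [i] and
    [k] differ ([theta_diff]). For suitable exponents ([expo]), [N] of them
    together with the constants form a square matrix whose determinant has
    exactly the degree of the product of the [m]-th powers of the differences;
    it is nonzero because an integral whose values at all nodes agree would
    vanish there too often ([theta_free]). If [p] is a compatible family of
    degree below that of every such integral, that is of degree at most
    [rho N r], replacing one integral by [p] gives a determinant still
    divisible by that product but of smaller degree, hence zero, and Cramer's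
    rule leaves only the constants. All this is done on generic lines, with
    polynomials in one variable ([nodes_line]); density and polarization then
    bring back the forms ([star_core], [polarize]).

    For the lower bound, the cells over a face [F] are merged by induction on
    the number of vertices of [F] ([flag_jets]). When the cells over each facet
    of [F] already carry one jet each, the facets of [F], coned from the point
    chosen in [F] and completed by the points chosen above [F], form a star as
    above, with [N >= k]; hence all the cells over [F] carry the same jet up to
    order [rho k r] ([star_step]).

    For the upper bound, the integral of least degree with [N = n] defines a
    piecewise polynomial on the cones over the facets of the whole simplex,
    homogeneous about [v] of degree [rho n r + 1] and smooth of order [r]
    across the walls, whose pieces do not all coincide ([rough_spline]). *)

Set Implicit Arguments.
Unset Strict Implicit.
Unset Printing Implicit Defensive.

Import Order.TTheory GRing.Theory Num.Theory.
Import numFieldNormedType.Exports.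

Local Open Scope ring_scope.

(** * Formal primitives *)

Section Primitive.
Variables (A : comNzRingType) (q : nat -> A).
Hypothesis qK : forall k, q k *+ k.+1 = 1.

(** The family [q] stands for the inverses of the positive integers, so that
    integration makes sense over a field and over polynomials in a parameter
    alike; this is the primitive that vanishes at [0]. *)
Definition prim (G : {poly A}) : {poly A} :=
  \poly_(k < (size G).+1) (if k is k'.+1 then G`_k' * q k' else 0).

(** The integral over the unit interval. *)
Definition int01 (G : {poly A}) : A := \sum_(k < size G) G`_k * q k.

Lemma int01_wide N (G : {poly A}) : (size G <= N)%N ->
  int01 G = \sum_(k < N) G`_k * q k.
Proof.
move=> leN; rewrite /int01 (big_ord_widen _ (fun k => G`_k * q k) leN).
rewrite big_mkcond; apply: eq_bigr => k _; case: ltnP => // h.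
by rewrite nth_default ?mul0r.
Qed.

Lemma coef_prim (G : {poly A}) k : (prim G)`_k.+1 = G`_k * q k.
Proof.
rewrite coef_poly ltnS; case: ltnP => // h.
by rewrite nth_default ?mul0r.
Qed.

Lemma deriv_prim (G : {poly A}) : (prim G)^`() = G.
Proof.
by apply/polyP=> k; rewrite coef_deriv coef_prim -mulrnAr qK mulr1.
Qed.

Lemma prim0 (G : {poly A}) : (prim G).[0] = 0.
Proof. by rewrite horner_coef0 coef_poly. Qed.

Lemma int01_deriv (Q : {poly A}) : int01 Q^`() = Q.[1] - Q.[0].
Proof.
have szQ : (size Q <= (size Q).-1.+1)%N by rewrite leqSpred.
rewrite (@int01_wide (size Q).-1); last exact: (leq_trans (size_poly _ _)).
rewrite (horner_coef_wide 1 szQ) horner_coef0 big_ord_recl expr0 mulr1.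
rewrite addrC addrA addNr add0r; apply: eq_bigr => k _.
by rewrite coef_deriv mulrnAl -mulrnAr qK mulr1 expr1n mulr1.
Qed.

Lemma int01Z (c : A) (G : {poly A}) : int01 (c *: G) = c * int01 G.
Proof.
rewrite (@int01_wide (size G)) ?size_scale_leq // /int01 mulr_sumr.
by apply: eq_bigr => k _; rewrite coefZ mulrA.
Qed.

(** The substitution [tau = a + (b - a) * sigma] turns the integral from [a] to
    [b] into one over the unit interval. *)
Lemma prim_sub (G : {poly A}) a b :
  (prim G).[b] - (prim G).[a] =
  (b - a) * int01 (G \Po (a%:P + (b - a) *: 'X)).
Proof.
set L := a%:P + (b - a) *: 'X.
have hL y : L.[y] = a + (b - a) * y by rewrite /L !hornerE.
have -> : (prim G).[b] - (prim G).[a] = (prim G \Po L).[1] - (prim G \Po L).[0].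
  by rewrite !horner_comp !hL mulr1 mulr0 addr0 [a + _]addrC subrK.
rewrite -int01_deriv deriv_comp deriv_prim.
have -> : L^`() = (b - a)%:P.
  by rewrite /L derivD derivC derivZ derivX add0r alg_polyC.
by rewrite mulrC mul_polyC int01Z.
Qed.

(** After the same substitution each factor vanishing at an endpoint contributes
    one power of [b - a], and the differential contributes one more. *)
Lemma prim_sub_dvd (G H : {poly A}) a b i j :
  G = ('X - a%:P) ^+ i * ('X - b%:P) ^+ j * H ->
  (prim G).[b] - (prim G).[a] = (b - a) ^+ (i + j).+1 *
    int01 ('X^i * ('X - 1) ^+ j * (H \Po (a%:P + (b - a) *: 'X))).
Proof.
move=> ->; rewrite prim_sub exprS -[RHS]mulrA; congr (_ * _).
rewrite -int01Z; congr int01.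
rewrite !rmorphM /= !rmorphXn /= !rmorphB /= !comp_polyX !comp_polyC.
have -> : a%:P + (b - a) *: 'X - a%:P = (b - a) *: 'X by rewrite addrC addKr.
have -> : a%:P + (b - a) *: 'X - b%:P = (b - a) *: ('X - 1).
  by rewrite scalerBr scalerBl addrAC -polyCB -!mul_polyC mulr1 !polyCB; ring.
by rewrite !exprZn -!mul_polyC !rmorphXn /= exprD; ring.
Qed.

End Primitive.

Section PrimMorph.
Variables (A B : comNzRingType) (q : nat -> A) (f : {rmorphism A -> B}).

Lemma prim_map (G : {poly A}) y :
  f (prim q G).[y] = (prim (f \o q) (map_poly f G)).[f y].
Proof.
rewrite -horner_map /=; congr (_.[_]).
apply/polyP=> -[|k]; rewrite coef_map /=; first by rewrite !coef_poly /= rmorph0.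
by rewrite !coef_prim rmorphM coef_map.
Qed.

End PrimMorph.

Lemma size_prod_bound (R : nzRingType) (I : Type) (r : seq I) (P : pred I)
    (F : I -> {poly R}) (D : I -> nat) :
  (forall i, P i -> (size (F i) <= (D i).+1)%N) ->
  (size (\prod_(i <- r | P i) F i)%R <= (\sum_(i <- r | P i) D i).+1)%N.
Proof.
move=> h; elim/big_rec2: _ => [|i n p Pi IH]; first by rewrite size_poly1.
apply: (leq_trans (size_polyMleq _ _)); move: (h i Pi) IH; lia.
Qed.

Lemma size_det_bound (R : comNzRingType) n (M : 'M[{poly R}]_n) (D : 'I_n -> nat) :
  (forall i j, (size (M i j) <= (D j).+1)%N) ->
  (size (\det M)%R <= (\sum_j D j).+1)%N.
Proof.
move=> h; apply: (leq_trans (size_sum _ _ _)).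
apply/bigmax_leqP => s _.
have : (size (\prod_i M i (s i))%R <= (\sum_j D j).+1)%N.
  rewrite [X in (_ <= X.+1)%N](reindex_inj (@perm_inj _ s)) /=.
  by apply: size_prod_bound => i _; apply: h.
by case: (odd_perm s); rewrite ?(expr0, expr1) ?mul1r // mulN1r size_polyN.
Qed.

(** Modulo [e] the matrix has two equal rows. *)
Lemma det_dvd (R : fieldType) n (M : 'M[{poly R}]_n) (e : {poly R}) i k :
  i != k -> (forall s, e %| M i s - M k s) -> e %| \det M.
Proof.
move=> ik h.
(* Row [i] of the matrix is row [k] plus [e] times a quotient row. *)
pose N := \matrix_(a, s) if a == i then M k s else M a s.
pose Q := \matrix_(a, s) if a == i then (M i s - M k s) %/ e else M a s.
have -> : \det M = 1 * \det N + e * \det Q.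
  apply: (@determinant_multilinear _ _ M N Q i).
  - apply/rowP=> s; rewrite !mxE eqxx mul1r [e * _]mulrC divpK //.
    by rewrite addrC subrK.
  - by apply/matrixP=> a s; rewrite !mxE eq_sym (negPf (neq_lift _ _)).
  - by apply/matrixP=> a s; rewrite !mxE eq_sym (negPf (neq_lift _ _)).
rewrite (@determinant_alternate _ _ N i k ik) ?mulr0 ?add0r ?dvdp_mulr //.
by move=> s; rewrite !mxE eqxx eq_sym (negPf ik).
Qed.

Lemma prod_dvd (R : fieldType) (I : eqType) (r : seq I) (F : I -> {poly R}) g :
  uniq r -> (forall i, i \in r -> F i %| g) ->
  {in r &, forall i j, i != j -> coprimep (F i) (F j)} ->
  \prod_(i <- r) F i %| g.
Proof.
elim: r => [|a r IH] /=; first by rewrite big_nil dvd1p.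
move=> /andP[ar ur] hd hc; rewrite big_cons Gauss_dvdp.
  rewrite hd ?mem_head //= IH // => [i ir|i j ir jr].
    by apply: hd; rewrite inE ir orbT.
  by apply: hc; rewrite inE ?ir ?jr orbT.
have: {in r, forall j, coprimep (F a) (F j)}.
  move=> j jr; apply: hc; rewrite ?mem_head ?inE ?jr ?orbT //.
  by apply: contraNneq ar => ->.
elim: (r) => [|b s IH2] h; first by rewrite big_nil coprimep1.
rewrite big_cons coprimepMr h ?mem_head //=.
by apply: IH2 => j js; apply: h; rewrite inE js orbT.
Qed.

Lemma size_prod_ge (R : idomainType) (I : Type) (r : seq I) (P : pred I)
    (F : I -> {poly R}) (D : I -> nat) :
  (forall i, P i -> (size (F i) = (D i).+1)%N) ->
  (size (\prod_(i <- r | P i) F i)%R = (\sum_(i <- r | P i) D i).+1)%N.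
Proof.
move=> h; elim/big_rec2: _ => [|i n p Pi IH]; first by rewrite size_poly1.
rewrite size_mul ?(h i Pi) ?IH -?size_poly_eq0 ?(h i Pi) ?IH //.
by rewrite addnS.
Qed.

(** * Integrals of nodal polynomials *)

Definition nodal (A : comNzRingType) n (x : 'I_n -> A) (e : 'I_n -> nat) : {poly A} :=
  \prod_l ('X - (x l)%:P) ^+ e l.

Section Nodal.
Variables (A : comNzRingType) (q : nat -> A).
Hypothesis qK : forall k, q k *+ k.+1 = 1.
Variables (n : nat) (x : 'I_n -> A) (e : 'I_n -> nat).

Lemma nodal_comp b c : nodal x e \Po (c%:P + b *: 'X) =
  \prod_l ((c - x l)%:P + b *: 'X) ^+ e l.
Proof.
rewrite /nodal rmorph_prod /=; apply: eq_bigr => l _.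
rewrite rmorphXn rmorphB /= comp_polyX comp_polyC polyCB; congr (_ ^+ _).
by rewrite addrAC.
Qed.

(** Seen on the unit interval, the integral is visibly homogeneous in [b] and the
    nodes, of degree one plus the sum of the exponents. *)
Lemma theta_int b : (prim q (nodal x e)).[b] =
  b * int01 q (\prod_l (b *: 'X - (x l)%:P) ^+ e l).
Proof.
rewrite -[LHS]subr0 -(prim0 q (nodal x e)) (prim_sub qK) subr0 nodal_comp.
congr (_ * int01 q _); apply: eq_bigr => l _.
by rewrite sub0r polyCN addrC.
Qed.

(** What is left of the integral from [x i] to [x k] once the power of
    [x k - x i] has been taken out. *)
Definition nodal_gap i k : A :=
  int01 q ('X^(e i) * ('X - 1) ^+ e k *
    \prod_(l | (l != i) && (l != k)) ((x i - x l)%:P + (x k - x i) *: 'X) ^+ e l).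

Lemma theta_diff i k : i != k ->
  (prim q (nodal x e)).[x k] - (prim q (nodal x e)).[x i] =
  (x k - x i) ^+ (e i + e k).+1 * nodal_gap i k.
Proof.
move=> ik; rewrite (@prim_sub_dvd _ _ qK (nodal x e)
  (\prod_(l | (l != i) && (l != k)) ('X - (x l)%:P) ^+ e l) (x i) (x k) (e i) (e k)).
  congr (_ * int01 q (_ * _)); rewrite rmorph_prod /=; apply: eq_bigr => l _.
  rewrite rmorphXn rmorphB /= comp_polyX comp_polyC polyCB; congr (_ ^+ _).
  by rewrite addrAC.
by rewrite /nodal (bigD1 i) //= (bigD1 k) //= ?mulrA // eq_sym.
Qed.

End Nodal.

(** A bound on the degree in the inner variable only: the outer one is to be
    integrated away. *)
Definition coefsize (R : nzRingType) (D : nat) (G : {poly {poly R}}) :=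
  forall k, (size (G`_k)%R <= D.+1)%N.

Lemma coefsizeM (R : nzRingType) D1 D2 (G H : {poly {poly R}}) :
  coefsize D1 G -> coefsize D2 H -> coefsize (D1 + D2) (G * H).
Proof.
move=> g h k; rewrite coefM; apply: (leq_trans (size_sum _ _ _)).
apply/bigmax_leqP => i _; apply: (leq_trans (size_polyMleq _ _)).
by move: (g i) (h (k - i)%N); lia.
Qed.

Lemma coefsizeX (R : nzRingType) D (G : {poly {poly R}}) j :
  coefsize D G -> coefsize (D * j) (G ^+ j).
Proof.
move=> g; elim: j => [|j IH]; last by rewrite exprS mulnS; apply: coefsizeM.
move=> k; rewrite muln0 expr0 coef1; case: (k == 0)%N; rewrite /= ?size_poly1 //.
by rewrite size_poly0.
Qed.

Lemma coefsize_prod (R : nzRingType) (I : Type) (r : seq I) D (G : I -> {poly {poly R}}) :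
  (forall i, coefsize (D i) (G i)) ->
  coefsize (\sum_(i <- r) D i)%N (\prod_(i <- r) G i).
Proof.
move=> h; elim/big_ind2: _ => //.
- move=> k; rewrite coef1; case: (k == 0)%N; rewrite /= ?size_poly1 //.
  by rewrite size_poly0.
- by move=> G1 D1 G2 D2; apply: coefsizeM.
Qed.

Section Theta.
Variable R : numFieldType.

Definition recip (k : nat) : R := k.+1%:R^-1.
Definition recip_poly (k : nat) : {poly R} := (recip k)%:P.

Lemma recipK k : recip k *+ k.+1 = 1.
Proof. by rewrite /recip -[RHS](mulVf (x := k.+1%:R)) ?pnatr_eq0 // mulr_natr. Qed.

Lemma recip_polyK k : recip_poly k *+ k.+1 = 1.
Proof. by rewrite /recip_poly -polyCMn recipK. Qed.

Lemma size_theta n (x : 'I_n -> {poly R}) e (b : {poly R}) :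
  (forall l, size (x l) <= 2)%N -> (size b <= 2)%N ->
  (size ((prim recip_poly (nodal x e)).[b])%R <= (\sum_l e l).+2)%N.
Proof.
move=> hx hb; rewrite (theta_int recip_polyK).
apply: (leq_trans (size_polyMleq _ _)).
suff h : (size (int01 recip_poly (\prod_l (b *: 'X - (x l)%:P) ^+ e l))%R
          <= (\sum_l e l).+1)%N.
  by rewrite -subn1 leq_subLR (leq_trans (leq_add hb h)).
apply: (leq_trans (size_sum _ _ _)); apply/bigmax_leqP => k _.
apply: (leq_trans (size_polyMleq _ _)).
have h1 : (size (recip_poly k) <= 1)%N by apply: size_polyC_leq1.
suff h : (size ((\prod_l (b *: 'X - (x l)%:P) ^+ e l)`_k)%R <= (\sum_l e l).+1)%N.
  by rewrite -subn1 leq_subLR (leq_trans (leq_add h h1)) ?addn1.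
apply: coefsize_prod => l; rewrite -[X in coefsize X _]mul1n; apply: coefsizeX => j.
rewrite coefB coefZ coefX coefC; apply: (leq_trans (size_polyD _ _)).
rewrite geq_max size_polyN; apply/andP; split.
  by case: (j == 1)%N; rewrite ?mulr1 ?mulr0 ?size_poly0 // .
by case: ifP => _; rewrite ?size_poly0.
Qed.

(** In characteristic zero differentiation lowers the multiplicity of a root by
    exactly one. *)
Lemma dvd_deriv_root (p : {poly R}) y w :
  root p y -> ('X - y%:P) ^+ w %| p^`() -> ('X - y%:P) ^+ w.+1 %| p.
Proof.
have [->|p0] := eqVneq p 0; first by rewrite dvdp0.
have [k [q]] := multiplicity_XsubC p y.
rewrite p0 /= => qy hq py; case: k hq => [|k] hq.
  by move: py; rewrite hq expr0 mulr1 (negPf qy).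
have [lt|le] := leqP w k; first by move=> _; rewrite hq; apply/dvdp_mull/dvdp_exp2l.
have -> : p^`() = (q^`() * ('X - y%:P) + q *+ k.+1) * ('X - y%:P) ^+ k.
  rewrite hq derivM deriv_exp derivXsubC mul1r exprS [RHS]mulrDl.
  by rewrite mulrA mulrnAr mulrnAl.
move=> h; have {h} : ('X - y%:P) * ('X - y%:P) ^+ k %|
    (q^`() * ('X - y%:P) + q *+ k.+1) * ('X - y%:P) ^+ k.
  by rewrite -exprS; apply: dvdp_trans h; apply: dvdp_exp2l.
rewrite dvdp_mul2r ?expf_neq0 ?polyXsubC_eq0 // dvdp_XsubCl /root.
rewrite !hornerE subrr mulr0 add0r hornerMn mulrn_eq0 /= => qy0.
by move: qy; rewrite /root qy0.
Qed.

Lemma size_nodal n (y : 'I_n -> R) e : size (nodal y e) = (\sum_l e l).+1.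
Proof.
by apply: size_prod_ge => l _; rewrite size_exp_XsubC.
Qed.

Lemma nodalD1 n (y : 'I_n -> R) e l : 
  nodal y e = ('X - (y l)%:P) ^+ e l * \prod_(i | i != l) ('X - (y i)%:P) ^+ e i.
Proof. by rewrite /nodal (bigD1 l). Qed.

Lemma size_prim (G : {poly R}) : (size (prim recip G) <= (size G).+1)%N.
Proof. exact: size_poly. Qed.

(** Suppose that a combination of the integrals takes the same value at all the
    nodes. Minus that value, it vanishes at each node to an order one more than
    its derivative does, so it has more roots, with multiplicity, than its degree
    allows; hence the combination of the integrands is zero. Looking at the nodes
    in turn, the first integrand with a nonzero coefficient would be the only one
    with too small a multiplicity at its own node. *)
Lemma theta_free N (y : 'I_N.+1 -> R) (e : 'I_N -> 'I_N.+1 -> nat)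
    (w : 'I_N.+1 -> nat) (c0 : R) (c : 'I_N -> R) :
  injective y ->
  (forall s l, w l <= e s l)%N ->
  (forall s, (\sum_l e s l).+1 < \sum_l (w l).+1)%N ->
  (forall s s' : 'I_N, (s < s')%N ->
    (e s (widen_ord (leqnSn N) s) < e s' (widen_ord (leqnSn N) s))%N) ->
  (forall i, c0 + \sum_s c s * (prim recip (nodal y (e s))).[y i] = 0) ->
  forall s, c s = 0.
Proof.
move=> yI hw hD htri h0.
pose Phi := c0%:P + \sum_s c s *: prim recip (nodal y (e s)).
have dPhi : Phi^`() = \sum_s c s *: nodal y (e s).
  rewrite /Phi derivD derivC add0r raddf_sum /=; apply: eq_bigr => s _.
  by rewrite derivZ (deriv_prim recipK).
have Phi0 : Phi = 0.
  have dv : \prod_(l <- enum 'I_N.+1) ('X - (y l)%:P) ^+ (w l).+1 %| Phi.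
    apply: prod_dvd => [|l _|i j _ _ ij]; first exact: enum_uniq.
      apply: dvd_deriv_root.
        rewrite /root /Phi hornerD hornerC horner_sum -[X in _ == X](h0 l).
        by apply/eqP; congr (_ + _); apply: eq_bigr => s _; rewrite hornerZ.
      rewrite dPhi; elim/big_rec: _ => [|s g _ hg]; first by rewrite dvdp0.
      apply: dvdp_add hg; rewrite -mul_polyC (nodalD1 _ _ l).
      by apply/dvdp_mull/dvdp_mulr/dvdp_exp2l.
    apply/coprimep_expl/coprimep_expr; rewrite coprimep_XsubC2 // subr_eq0.
    by apply: contraNneq ij => /yI ->.
  apply: contraTeq dv => nz; apply/negP=> /(dvdp_leq nz).
  rewrite big_enum /= (@size_prod_ge _ _ _ _ _ (fun l => (w l).+1)); last first.
    by move=> l _; rewrite size_exp_XsubC.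
  apply/negP; rewrite -ltnNge ltnS.
  apply: (leq_trans (size_polyD _ _)); rewrite geq_max.
  have hpos : (0 < \sum_(l < N.+1) (w l).+1)%N by rewrite big_ord_recl.
  apply/andP; split; first exact: (leq_trans (size_polyC_leq1 _)).
  apply: (leq_trans (size_sum _ _ _)); apply/bigmax_leqP => s _.
  apply: (leq_trans (size_scale_leq _ _)); apply: (leq_trans (size_prim _)).
  by rewrite size_nodal; apply: hD.
have {dPhi} S0 : \sum_s c s *: nodal y (e s) = 0 by rewrite -dPhi Phi0 deriv0.
have IH k : forall s : 'I_N, s = k :> nat -> c s = 0.
  elim/ltn_ind: k => k IH s sk; apply/eqP; apply/negPn/negP => cs.
  pose ys := widen_ord (leqnSn N) s.
  have d1 : ('X - (y ys)%:P) ^+ (e s ys).+1 %| c s *: nodal y (e s).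
    move: S0; rewrite (bigD1 s) //= => /eqP; rewrite addr_eq0 => /eqP ->.
    rewrite dvdpNr; elim/big_rec: _ => [|s' g ss hg]; first by rewrite dvdp0.
    apply: dvdp_add hg; rewrite -mul_polyC.
    case: (ltngtP s' s) => hs; last by rewrite (val_inj hs) eqxx in ss.
      by rewrite (IH s') -?sk // mul0r dvdp0.
    rewrite (nodalD1 _ _ ys); apply/dvdp_mull/dvdp_mulr/dvdp_exp2l.
    exact: htri.
  move: d1; rewrite dvdpZr // (nodalD1 _ _ ys) exprSr.
  rewrite dvdp_mul2l ?expf_neq0 ?polyXsubC_eq0 // dvdp_XsubCl => /rootP.
  rewrite horner_prod => /eqP; apply/negP/prodf_neq0 => l ls.
  rewrite horner_exp hornerXsubC expf_neq0 // subr_eq0.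
  by apply: contraNneq ls => /yI ->.
by move=> s; apply: IH.
Qed.

End Theta.

(** * Compatible families along a line *)

Section Nodes.
Variables (R : numFieldType) (N m d : nat).
Variables (e : 'I_N -> 'I_N.+1 -> nat) (w : 'I_N.+1 -> nat).
Hypothesis hpair : forall s i k, i != k -> (m <= (e s i + e s k).+1)%N.
Hypothesis hw : forall s l, (w l <= e s l)%N.
Hypothesis hD : forall s, ((\sum_l e s l).+1 < \sum_l (w l).+1)%N.
Hypothesis htri : forall s s' : 'I_N, (s < s')%N ->
  (e s (widen_ord (leqnSn N) s) < e s' (widen_ord (leqnSn N) s))%N.
Hypothesis hsum : (\sum_s (\sum_l e s l).+1 = \sum_(k < N.+1) m * k)%N.
Hypothesis hd : forall s, (d <= \sum_l e s l)%N.

Variables (x p : 'I_N.+1 -> {poly R}).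
Hypothesis hx : forall l, (size (x l) <= 2)%N.
Hypothesis hx2 : forall i k, i != k -> size (x i - x k) = 2.
Hypothesis hcop : forall i k i' k' : 'I_N.+1, (i < k)%N -> (i' < k')%N ->
  (i, k) != (i', k') -> coprimep (x i - x k) (x i' - x k').
Hypothesis hx0 : injective (fun i => (x i).[0]).
Hypothesis hp : forall i, (size (p i) <= d.+1)%N.
Hypothesis hdvd : forall i k, i != k -> (x i - x k) ^+ m %| p i - p k.

Let theta s i := (prim (recip_poly R) (nodal x (e s))).[x i].

Let theta_dvd s i k : i != k -> (x i - x k) ^+ m %| theta s i - theta s k.
Proof.
move=> ik; rewrite (theta_diff (@recip_polyK R)) 1?eq_sym //.
by apply/dvdp_mulr/dvdp_exp2l; rewrite hpair // eq_sym.
Qed.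

Let M (s0 : 'I_N) : 'M[{poly R}]_N.+1 :=
  \matrix_(i, s) if unlift ord0 s is Some s' then
                   if s' == s0 then p i else theta s' i
                 else 1.

(** The determinant is divisible by the product of the [m]-th powers of all the
    differences of nodes, whose degree is the total degree of the integrals; the
    family [p] has smaller degree than the integral that it replaces. *)
Let detM0 s0 : \det (M s0) = 0.
Proof.
pose r := [seq ik : 'I_N.+1 * 'I_N.+1 <- enum {: 'I_N.+1 * 'I_N.+1} | (ik.1 < ik.2)%N].
have dv : \prod_(ik <- r) (x ik.1 - x ik.2) ^+ m %| \det (M s0).
  apply: prod_dvd => [|[i k]|[i k] [i' k']] /=.
  - by rewrite filter_uniq // enum_uniq.
  - rewrite mem_filter /= => /andP[ik _].
    have nik : i != k by rewrite -(inj_eq val_inj) neq_ltn ik.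
    apply: (det_dvd nik) => s; rewrite !mxE.
    case: (unlift ord0 s) => [s'|]; last by rewrite subrr dvdp0.
    by case: ifP => _; [apply: hdvd|apply: theta_dvd].
  - rewrite !mem_filter /= => /andP[ik _] /andP[ik' _] ne.
    by apply/coprimep_expl/coprimep_expr/hcop.
apply: contraTeq dv => nz; apply/negP=> /(dvdp_leq nz).
rewrite big_filter big_enum_cond /= (@size_prod_ge _ _ _ _ _ (fun=> m)); last first.
  move=> [i k] /= ik; have nik : i != k by rewrite -(inj_eq val_inj) neq_ltn ik.
  have h2 := hx2 nik; rewrite -[LHS]prednK ?size_exp ?h2 ?mul1n //.
  by rewrite size_poly_gt0 expf_neq0 // -size_poly_gt0 h2.
apply/negP; rewrite -ltnNge ltnS.
pose D (s : 'I_N.+1) := if unlift ord0 s is Some s' then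
  if s' == s0 then d else (\sum_l e s' l).+1 else 0%N.
apply: (@leq_trans (\sum_s D s).+1).
  apply: size_det_bound => i s; rewrite !mxE /D.
  case: (unlift ord0 s) => [s'|]; last by rewrite size_poly1.
  by case: ifP => _ //; apply: size_theta.
have -> : (\sum_(i : 'I_N.+1 * 'I_N.+1 | (i.1 < i.2)%N) m = \sum_(k < N.+1) m * k)%N.
  rewrite -(pair_big_dep xpredT (fun i k : 'I_N.+1 => (i < k)%N) (fun _ _ => m)) /=.
  rewrite (exchange_big_dep xpredT) //=; apply: eq_bigr => k _.
  rewrite -(big_ord_widen _ (fun=> m)) ?sum_nat_const ?card_ord 1?mulnC //.
  exact: ltnW.
rewrite -hsum big_ord_recl {1}/D unlift_none add0n.
rewrite (bigD1 s0) //= [X in (_ < X)%N](bigD1 s0) //= /D liftK eqxx.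
rewrite -addSn leq_add //; first by rewrite ltnS.
by apply: leq_sum => s ss; rewrite liftK (negPf ss).
Qed.

Let y i := (x i).[0].
Let th0 s i : R := (prim (recip R) (nodal y (e s))).[y i].

Let theta0 s i : (theta s i).[0] = th0 s i.
Proof.
rewrite /theta -[LHS]/(horner_eval 0 _) prim_map /= /th0 /y.
have -> : map_poly (horner_eval 0) (nodal x (e s)) = nodal (fun i => (x i).[0]) (e s).
  rewrite /nodal rmorph_prod /=; apply: eq_bigr => l _.
  by rewrite rmorphXn rmorphB /= map_polyX map_polyC.
congr (_.[_]); apply/polyP=> k; rewrite /prim !coef_poly.
by case: ifP => // _; case: k => // k; rewrite /= /horner_eval /recip_poly hornerC.
Qed.

Let free0 (c0 : R) c :
  (forall i, c0 + \sum_s c s * th0 s i = 0) -> forall s, c s = 0.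
Proof. by apply: theta_free. Qed.

(** Cramer's rule: the values of [p] at [0] are a combination of the columns in
    which any prescribed integral can be left out. *)
Let expand s0 : exists (c0 : R) (c : 'I_N -> R), c s0 = 0 /\
  forall i, (p i).[0] = c0 + \sum_s c s * th0 s i.
Proof.
have : \det (map_mx (horner_eval 0) (M s0))^T == 0.
  by rewrite det_tr det_map_mx detM0 rmorph0.
move=> /det0P[v v0 hv].
have hrel i : v 0 ord0 + \sum_s v 0 (lift ord0 s) *
    (if s == s0 then (p i).[0] else th0 s i) = 0.
  have /rowP/(_ i) := hv; rewrite !mxE big_ord_recl !mxE unlift_none.
  rewrite /= {1}/horner_eval hornerC mulr1 => h; rewrite -[RHS]h; congr (_ + _).
  apply: eq_bigr => s _; rewrite !mxE liftK; congr (_ * _).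
  by case: ifP => _ //; rewrite -theta0.
pose b := v 0 (lift ord0 s0).
have split_b i : v 0 ord0 + \sum_s (if s == s0 then 0 else v 0 (lift ord0 s)) *
    th0 s i = - (b * (p i).[0]).
  apply: (addIr (b * (p i).[0])); rewrite addNr -[RHS](hrel i) -addrA; congr (_ + _).
  rewrite (bigD1 s0) //= [in RHS](bigD1 s0) //= eqxx mul0r add0r addrC -/b.
  congr (_ + _); apply: eq_bigr => s /negPf ss.
  by rewrite ss.
have [b0|b0] := eqVneq b 0.
  case/negP: v0; apply/eqP/rowP=> s; rewrite [RHS]mxE.
  have cs : forall s, (if s == s0 then 0 else v 0 (lift ord0 s)) = 0.
    by apply: (free0 (c0 := v 0 ord0)) => i; rewrite split_b b0 mul0r oppr0.
  have v00 : v 0 ord0 = 0.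
    have := split_b ord0; rewrite b0 mul0r oppr0 big1 ?addr0 // => s' _.
    by rewrite cs mul0r.
  case: (unliftP ord0 s) => [s'|] ->; last exact: v00.
  by have := cs s'; case: (s' =P s0) => [->|].
exists (- (v 0 ord0 / b)), (fun s => - ((if s == s0 then 0 else v 0 (lift ord0 s)) / b)).
split=> [|i]; first by rewrite eqxx mul0r oppr0.
apply: (mulfI b0); apply: oppr_inj; rewrite -split_b mulrDr opprD mulrN opprK.
rewrite mulrCA divff // mulr1; congr (_ + _).
rewrite mulr_sumr -sumrN; apply: eq_bigr => s _.
by rewrite mulNr mulrN opprK mulrA mulrCA divff // mulr1.
Qed.

(** The expansion along the columns is unique, and each integral can be left out
    of it, so only the constant column remains. *)
Theorem nodes_line i k : (p i).[0] = (p k).[0].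
Proof.
have [N0|Npos] := posnP N.
  have one (l : 'I_N.+1) : l = ord0.
    by apply: val_inj => /=; case: l => [[|l]] //=; rewrite N0.
  by rewrite (one i) (one k).
have [c0 [c [_ hc]]] := expand (Ordinal Npos).
have c_eq0 s : c s = 0.
  have [b0 [b [bs hb]]] := expand s.
  suff /(_ s) /eqP : forall s, c s - b s = 0 by rewrite bs subr0 => /eqP.
  apply: (free0 (c0 := c0 - b0)) => l; under eq_bigr do rewrite mulrBl.
  by rewrite sumrB addrACA -opprD -hc -hb subrr.
by rewrite !hc; congr (_ + _); apply: eq_bigr => s _; rewrite c_eq0 !mul0r.
Qed.

End Nodes.

(** * Systems of exponents *)

Section Exponents.
Variables (m N : nat).
Local Open Scope nat_scope.

(** The exponents at any two nodes must add up to at least [m - 1], while the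
    degrees of the [N] integrals may not add up to more than the degree of the
    product of the [m]-th powers of the differences of nodes. For odd [m] the
    balanced exponents [m./2] are just sufficient, and an extra unit at the first
    [s] nodes makes the integrands independent; for even [m] they leave one unit
    to spare, which is taken off at the node [s]. *)
Definition expo (s l : nat) : nat :=
  if odd m then m./2 + (l < s) else m./2 - (l == s).

(** The multiplicity that all the integrands share at a node. *)
Definition expo_min (l : nat) : nat := if odd m then m./2 else m./2 - (l < N).

Hypothesis m_gt0 : 0 < m.

Lemma half_gt0 : ~~ odd m -> 0 < m./2.
Proof. by lia. Qed.

Lemma expo_pair s i k : i != k -> m <= (expo s i + expo s k).+1.
Proof.
move=> ik; rewrite /expo; case: ifP => o; first by lia.
case: (i =P s) => [is_|_]; case: (k =P s) => [ks|_] /=; try lia.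
Qed.

Lemma expo_min_le (s : 'I_N) l : expo_min l <= expo s l.
Proof.
rewrite /expo /expo_min; case: ifP => o; first by lia.
by case: (l =P s :> nat) => [->|_]; rewrite ?ltn_ord //; lia.
Qed.

Lemma expo_sum (s : 'I_N.+1) :
  \sum_(l < N.+1) expo s l = if odd m then N.+1 * m./2 + s else (N.+1 * m./2).-1.
Proof.
rewrite /expo; case: ifP => o.
  rewrite big_split /= sum_nat_const card_ord; congr (_ + _).
  rewrite -big_mkcond /= -(big_ord_widen _ (fun=> 1)) ?sum1_card ?card_ord //.
  exact: ltnW.
have h := half_gt0 (negbT o).
rewrite (bigD1 s) //= eqxx (eq_bigr (fun=> m./2)) => [|l ls]; last first.
  by rewrite (inj_eq val_inj) (negPf ls) subn0.
by rewrite sum_nat_const cardC1 card_ord; lia.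
Qed.

Lemma expo_min_sum : \sum_(l < N.+1) (expo_min l).+1 =
  if odd m then N.+1 * (m./2).+1 else (N.+1 * m./2).+1.
Proof.
rewrite /expo_min; case: ifP => o; first by rewrite sum_nat_const card_ord.
have h := half_gt0 (negbT o).
rewrite big_ord_recr /= ltnn subn0 (eq_bigr (fun=> m./2)) => [|l _]; last first.
  by rewrite ltn_ord; lia.
by rewrite sum_nat_const card_ord; lia.
Qed.

Lemma expo_deg (s : 'I_N) :
  (\sum_(l < N.+1) expo s l).+1 < \sum_(l < N.+1) (expo_min l).+1.
Proof.
rewrite (expo_sum (widen_ord (leqnSn N) s)) expo_min_sum /=.
have := ltn_ord s; case: ifP => o; first by lia.
by have := half_gt0 (negbT o); lia.
Qed.

Lemma expo_tri (s s' : nat) : s < s' -> expo s s < expo s' s.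
Proof.
rewrite /expo => ss; case: ifP => o; first by rewrite ss ltnn; lia.
by have := half_gt0 (negbT o); rewrite eqxx (ltn_eqF ss); lia.
Qed.

(** Both sides are [m * N * (N + 1) / 2]. *)
Lemma expo_total :
  \sum_(s < N) (\sum_(l < N.+1) expo s l).+1 = \sum_(k < N.+1) m * k.
Proof.
have -> : \sum_(k < N.+1) m * k = m * 'C(N.+1, 2).
  by rewrite -big_distrr /= -bin2_sum big_mkord.
have e s : (\sum_(l < N.+1) expo (s : 'I_N) l).+1 =
    if odd m then (N.+1 * m./2).+1 + s else N.+1 * m./2.
  rewrite (expo_sum (widen_ord (leqnSn N) s)) /=; case: ifP => o; first by lia.
  by have := half_gt0 (negbT o); lia.
under eq_bigr do rewrite e.
have hC : 'C(N, 2) * 2 = N * N.-1.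
  rewrite bin2 -divn2 divnK ?dvdn2 //; case: (N) => //= k.
  by rewrite oddM /=; case: (odd k).
have hC' : 'C(N.+1, 2) = 'C(N, 2) + N by rewrite (binS N 1) bin1.
case o: (odd m).
  rewrite big_split /= sum_nat_const card_ord.
  have -> : \sum_(i < N) i = 'C(N, 2) by rewrite -bin2_sum big_mkord.
  have : m = (m./2) * 2 + 1 by lia.
  rewrite hC'; move: hC (m./2) => + h ->; case: (N) => [|k] /=; last by nia.
  by rewrite bin0n; lia.
rewrite sum_nat_const card_ord.
have : m = (m./2) * 2 by lia.
rewrite hC'; move: hC (m./2) => + h ->; case: (N) => [|k] /=; last by nia.
by rewrite bin0n; lia.
Qed.

End Exponents.

Section Jets.
Variables (A : comNzRingType) (n : nat).
Implicit Types (J K : seq 'I_n -> A) (u v b : 'rV[A]_n).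

(** A jet [J] lists the iterated partial derivatives of a function at a point,
    and [jshift u J] is the jet of its derivative in the direction [u]. The value
    of the iterates of [jshift u] at the empty word is the Taylor form in [u]. *)
Definition jshift u J : seq 'I_n -> A := fun w => \sum_i u 0 i * J (i :: w).

Definition jsym J := forall w w', perm_eq w w' -> J w = J w'.

Lemma jsym_jshift u J : jsym J -> jsym (jshift u J).
Proof.
move=> sJ w w' ww; apply: eq_bigr => i _; congr (_ * _); apply: sJ.
by rewrite perm_cons.
Qed.

Lemma jsym_iter u J k : jsym J -> jsym (iter k (jshift u) J).
Proof. by move=> sJ; elim: k => //= k IH; apply: jsym_jshift. Qed.

Lemma jshiftC u v J : jsym J -> jshift u (jshift v J) = jshift v (jshift u J).
Proof.
move=> sJ; apply/funext => w; rewrite /jshift.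
under eq_bigr do rewrite mulr_sumr; under [RHS]eq_bigr do rewrite mulr_sumr.
rewrite exchange_big; apply: eq_bigr => i _; apply: eq_bigr => j _.
by rewrite mulrCA; congr (_ * (_ * _)); apply: sJ; apply/seq.permP => a /=; rewrite addnCA.
Qed.

Lemma iter_jshiftC u v J k : jsym J ->
  iter k (jshift u) (jshift v J) = jshift v (iter k (jshift u) J).
Proof.
by move=> sJ; elim: k => //= k ->; rewrite jshiftC //; apply: jsym_iter.
Qed.

Lemma iter_iter_jshiftC u v J k l : jsym J ->
  iter k (jshift u) (iter l (jshift v) J) = iter l (jshift v) (iter k (jshift u) J).
Proof.
by move=> sJ; elim: l => //= l <-; rewrite iter_jshiftC //; apply: jsym_iter.
Qed.

Lemma jshift_lin u (c : A) J K : jshift u (fun w => c * J w + K w) =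
  fun w => c * jshift u J w + jshift u K w.
Proof.
apply/funext => w; rewrite /jshift mulr_sumr -big_split; apply: eq_bigr => i _ /=.
by rewrite mulrDr mulrCA.
Qed.

Lemma iter_jshift_lin u (c : A) J K k : iter k (jshift u) (fun w => c * J w + K w) =
  fun w => c * iter k (jshift u) J w + iter k (jshift u) K w.
Proof. by elim: k => //= k ->; rewrite jshift_lin. Qed.

Lemma iter_jshiftB u J K k : iter k (jshift u) (fun w => J w - K w) =
  fun w => iter k (jshift u) J w - iter k (jshift u) K w.
Proof.
have -> : (fun w => J w - K w) = (fun w => -1 * K w + J w).
  by apply/funext => w; rewrite mulN1r addrC.
by rewrite iter_jshift_lin; apply/funext => w; rewrite mulN1r addrC.
Qed.

(** The Taylor form of a given degree only sees the derivatives of that order. *)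
Lemma eq_iter_jshift u J K k w :
  (forall w', size w' = (k + size w)%N -> J w' = K w') ->
  iter k (jshift u) J w = iter k (jshift u) K w.
Proof.
elim: k w => [|k IH] w h /=; first exact: h.
by apply: eq_bigr => i _; congr (_ * _); apply: IH => w' sw; apply: h; rewrite sw addnS.
Qed.

(** By symmetry the derivatives in the directions [u] and [b] commute, so that
    the binomial formula applies. *)
Lemma iter_jshift_binomial u b (y : A) J d w : jsym J ->
  iter d (jshift (u + y *: b)) J w = \sum_(k < d.+1)
    (y ^+ k *+ 'C(d, k)) * iter (d - k) (jshift u) (iter k (jshift b) J) w.
Proof.
elim: d J w => [|d IH] J w sJ.
  by rewrite big_ord_recl big_ord0 /= bin0 expr0 mulr1n mul1r addr0.
have -> : iter d.+1 (jshift (u + y *: b)) J w =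
    iter d (jshift (u + y *: b)) (jshift u J) w +
    y * iter d (jshift (u + y *: b)) (jshift b J) w.
  rewrite iterSr.
  have -> : jshift (u + y *: b) J = fun w => y * jshift b J w + jshift u J w.
    apply/funext => w'; rewrite /jshift mulr_sumr -big_split; apply: eq_bigr => i _.
    by rewrite !mxE mulrDl mulrA addrC.
  by rewrite iter_jshift_lin addrC.
rewrite !IH; try exact: jsym_jshift.
rewrite big_ord_recl [in RHS]big_ord_recl /= !bin0 !subn0 expr0 mulr1n !mul1r.
rewrite -addrA; congr (_ + _).
  by rewrite -iterS -iterSr.
rewrite [X in X + _](_ : _ = \sum_(k < d.+1) (y ^+ k.+1 *+ 'C(d, k.+1)) *
    iter (d - k) (jshift u) (iter k.+1 (jshift b) J) w); last first.
  rewrite [RHS]big_ord_recr /= bin_small // mulr0n mul0r addr0.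
  apply: eq_bigr => k _; rewrite /bump add1n; congr (_ * _).
  rewrite -[jshift b (iter (0 + k) _ _)]/(iter k.+1 (jshift b) (jshift u J)).
  rewrite (@iter_jshiftC b u) // -iterSr -subSn ?ltn_ord //.
rewrite mulr_sumr -big_split; apply: eq_bigr => k _ /=.
rewrite /bump add1n subSS -!iterS -iterSr /= binS mulrnDr mulrDl; congr (_ + _).
by rewrite mulrA mulrnAr -exprS.
Qed.

End Jets.

Lemma jshift_map (A B : comNzRingType) (f : {rmorphism A -> B}) n (u : 'rV[A]_n) J k w :
  f (iter k (jshift u) J w) = iter k (jshift (map_mx f u)) (f \o J) w.
Proof.
elim: k w => //= k IH w; rewrite rmorph_sum; apply: eq_bigr => i _.
by rewrite rmorphM IH mxE.
Qed.

Lemma size_iter_jshift (R : comNzRingType) n (U : 'rV[{poly R}]_n)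
    (J : seq 'I_n -> {poly R}) d w :
  (forall i, (size (U 0%R i) <= 2)%N) -> (forall w, (size (J w) <= 1)%N) ->
  (size (iter d (jshift U) J w) <= d.+1)%N.
Proof.
move=> hU hJ; elim: d w => [|d IH] w //=.
apply: (leq_trans (size_sum _ _ _)); apply/bigmax_leqP => i _.
apply: (leq_trans (size_polyMleq _ _)); rewrite -subn1 leq_subLR.
by apply: (leq_trans (leq_add (hU i) (IH (i :: w)))).
Qed.

Section Infinite.
Variable R : numDomainType.

Lemma poly_all_root (p : {poly R}) : (forall y, p.[y] = 0) -> p = 0.
Proof.
move=> h; apply/eqP/negPn/negP => p0.
have := @max_poly_roots _ p [seq i%:R | i <- iota 0 (size p)] p0.
rewrite size_map size_iota ltnn => H; suff: false by []; apply: H.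
  by apply/allP=> _ /mapP[i _ ->]; apply/rootP.
by rewrite map_inj_uniq ?iota_uniq // => i j /eqP; rewrite eqr_nat => /eqP.
Qed.

(** The linear coefficient in [y] of the form at [u + y * e_i] is a multiple of
    the form of the derivative along [e_i]. *)
Lemma polarize n (J : seq 'I_n -> R) d : jsym J ->
  (forall u, iter d (jshift u) J [::] = 0) -> forall w, size w = d -> J w = 0.
Proof.
elim: d J => [|d IH] J sJ h w sw; first by case: w sw => // _; apply: (h 0).
case: w sw => // i w [sw].
have ei : jshift (delta_mx 0 i) J = fun w => J (i :: w).
  apply/funext => w'; rewrite /jshift (bigD1 i) //= mxE !eqxx mul1r big1 ?addr0 //.
  by move=> k /negPf ki; rewrite mxE ki andbF mul0r.
suff H u : iter d (jshift u) (jshift (delta_mx 0 i) J) [::] = 0.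
  by have := IH _ (jsym_jshift _ sJ) H w sw; rewrite ei.
pose c k := iter (d.+1 - k) (jshift u) (iter k (jshift (delta_mx 0 i)) J) [::] *+ 'C(d.+1, k).
have P0 : \poly_(k < d.+2) c k = 0.
  apply: poly_all_root => y; rewrite horner_poly -[RHS](h (u + y *: delta_mx 0 i)).
  rewrite iter_jshift_binomial //; apply: eq_bigr => k _.
  by rewrite /c mulrnAl mulrnAl mulrC.
have := congr1 (fun p : {poly R} => p`_1) P0; rewrite coef_poly coef0 /= /c subSS subn0.
by rewrite bin1 => /eqP; rewrite mulrn_eq0 /= => /eqP.
Qed.

End Infinite.

(** * Jets at the centre of a star of cells *)

Section Star.
Variables (R : numFieldType) (N r d n : nat).
Hypothesis N_gt0 : (0 < N)%N.
Hypothesis d_le : (d <= r + (N - 1) * (r.+1)./2)%N.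
Variables (y0 : 'rV[R]_n) (E : 'I_N.+1 -> 'rV[R]_n).
Let pt (a : 'I_N.+1 -> R) := y0 + \sum_l a l *: E l.
Variable J : 'I_N.+1 -> seq 'I_n -> R.
Hypothesis J_sym : forall i, jsym (J i).
Hypothesis J_facet : forall i k, i != k -> forall a, a i = a k ->
  forall e w, (size w <= r)%N -> (e + size w = d)%N ->
  iter e (jshift (pt a)) (J i) w = iter e (jshift (pt a)) (J k) w.

(** A generic line through [pt a] crosses the walls one at a time. Where it meets
    the wall between the cells [i] and [k], the derivatives of the difference of
    the two forms along the line vanish up to order [r]; this is the
    compatibility that the result on families of one-variable polynomials
    requires. *)
Lemma star_line (a b : 'I_N.+1 -> R) i0 k0 :
  injective a -> injective b ->
  (forall i k i' k' : 'I_N.+1, (i < k)%N -> (i' < k')%N -> (i, k) != (i', k') ->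
     (b i' - b k') * (a i - a k) != (b i - b k) * (a i' - a k')) ->
  iter d (jshift (pt a)) (J i0) [::] = iter d (jshift (pt a)) (J k0) [::].
Proof.
move=> aI bI ab.
pose B := \sum_l b l *: E l.
pose U (t : {poly R}) u : 'rV[{poly R}]_n := map_mx polyC u + t *: map_mx polyC B.
pose p i := iter d (jshift (U 'X (pt a))) (polyC \o J i) [::].
pose x i := (a i)%:P + b i *: 'X.
have bne i k : i != k -> b i - b k != 0.
  by move=> ik; rewrite subr_eq0; apply: contraNneq ik => /bI ->.
have xE i k : x i - x k = (a i - a k)%:P + (b i - b k) *: 'X.
  by rewrite /x scalerBl polyCB; ring.
have p0 i : (p i).[0] = iter d (jshift (pt a)) (J i) [::].
  rewrite -[LHS]/(horner_eval 0 _) jshift_map.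
  have -> : map_mx (horner_eval 0) (U 'X (pt a)) = pt a.
    by apply/rowP=> j; rewrite !mxE /= /horner_eval !hornerE.
  by congr (iter d _ _ _); apply/funext => w; rewrite /= /horner_eval hornerC.
rewrite -!p0.
apply: (@nodes_line R N r.+1 d (fun (s : 'I_N) (l : 'I_N.+1) => expo r.+1 s l)
   (fun l : 'I_N.+1 => expo_min r.+1 N l)
   _ _ _ _ _ _ x p).
- by move=> s i k ik; apply: expo_pair.
- by move=> s l; apply: expo_min_le.
- by move=> s; apply: expo_deg.
- by move=> s s' ss; apply: expo_tri.
- exact: expo_total.
- move=> s; rewrite (expo_sum _ (widen_ord (leqnSn N) s)) //=.
  have [N' NE] : exists N', N = N'.+1 by exists N.-1; rewrite prednK.
  move: (nat_of_ord s) d_le => s1; rewrite NE subn1 /= => h.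
  have [ro|ro] := boolP (odd r) => /=.
    have : (r = uphalf r * 2 - 1)%N by lia.
    by move: h; case: (uphalf r) => [|u] h1 h2; nia.
  have : (r = uphalf r * 2)%N by lia.
  by move: h (uphalf r) => h u; nia.
- move=> l; apply: (leq_trans (size_polyD _ _)); rewrite geq_max.
  rewrite (leq_trans (size_polyC_leq1 _)) //=.
  by rewrite (leq_trans (size_scale_leq _ _)) // size_polyX.
- move=> i k ik; rewrite xE addrC size_polyDl size_scale ?size_polyX ?bne //.
  by rewrite ltnS size_polyC_leq1.
- move=> i k i' k' ik ik' ne; apply/Bezout_coprimepP.
  exists ((b i' - b k')%:P, - (b i - b k)%:P) => /=.
  rewrite !xE.
  have -> : (b i' - b k')%:P * ((a i - a k)%:P + (b i - b k) *: 'X) +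
     - (b i - b k)%:P * ((a i' - a k')%:P + (b i' - b k') *: 'X) =
     ((b i' - b k') * (a i - a k) - (b i - b k) * (a i' - a k'))%:P.
    by rewrite -!mul_polyC !rmorphB !rmorphM /= !rmorphB /=; ring.
  by rewrite -size_poly_eq1 size_polyC subr_eq0 ab.
- by move=> i k; rewrite /x !hornerE => /aI.
- move=> i; apply: size_iter_jshift => [j|w]; last exact: size_polyC_leq1.
  rewrite !mxE; apply: (leq_trans (size_polyD _ _)); rewrite geq_max.
  rewrite (leq_trans (size_polyC_leq1 _)) //= mulrC mul_polyC.
  by rewrite (leq_trans (size_scale_leq _ _)) // size_polyX.
move=> i k ik.
(* The line meets the wall between the cells [i] and [k] at [t0]; centred there,
   the terms of order at most [r] of the binomial expansion cancel. *)
pose t0 := - (a i - a k) / (b i - b k).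
have -> : x i - x k = (b i - b k) *: ('X - t0%:P).
  rewrite xE /t0 scalerBr -[_ *: _%:P]mul_polyC -polyCM mulrC mulrAC.
  by rewrite -mulrA divff ?bne // mulr1 polyCN opprK addrC.
rewrite exprZn dvdpZl ?expf_neq0 ?bne //.
pose a' l := a l + t0 * b l.
have a'ik : a' i = a' k.
  apply/eqP; rewrite /a' -subr_eq0 opprD addrACA -mulrBr /t0.
  by rewrite -mulrA mulVf ?bne // mulr1 subrr.
have UE : U 'X (pt a) = U ('X - t0%:P) (pt a').
  have ptE : pt a' = pt a + t0 *: B.
    rewrite /pt /B scaler_sumr -addrA -big_split; congr (_ + _).
    by apply: eq_bigr => l _; rewrite scalerDl scalerA.
  rewrite /U ptE; clear; move: (pt a) B => u v.
  by apply/rowP=> j; rewrite !mxE polyCD polyCM; ring.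
rewrite /p UE /U.
have sym l : jsym (polyC \o J l) by move=> w w' ww /=; rewrite (J_sym l ww).
rewrite !iter_jshift_binomial // -sumrB.
elim/big_rec: _ => [|e g _ hg]; first by rewrite dvdp0.
apply: dvdp_add hg; rewrite -mulrBr.
have [re|er] := ltnP r e; first by rewrite dvdp_mulr // -mulr_natl dvdp_mull // dvdp_exp2l.
rewrite -!(@iter_iter_jshiftC _ _ (map_mx polyC (B))) //.
rewrite [X in _ * X](_ : _ = 0); first by rewrite mulr0 dvdp0.
apply/eqP; rewrite subr_eq0; apply/eqP; apply: eq_iter_jshift => w; rewrite addn0 => we.
rewrite -![LHS](jshift_map polyC) -![RHS](jshift_map polyC); congr polyC.
apply: J_facet => //; first by rewrite we.
by rewrite we subnK // -ltnS.
Qed.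

(** Powers of two form a Sidon set: this provides a direction along which almost
    every point is generic. *)
Lemma pow2_sidon i k i' k' : (i < k)%N -> (i' < k')%N -> (i, k) != (i', k') ->
  (2 ^ i + 2 ^ k != 2 ^ i' + 2 ^ k')%N.
Proof.
move=> ik ik'; apply: contraNneq => h.
have aux a b a' b' : (a < b)%N -> (a' < b')%N -> (2 ^ a + 2 ^ b = 2 ^ a' + 2 ^ b')%N ->
   ~ (b < b')%N.
  move=> ab ab' e bb.
  have h1 : (2 ^ b.+1 <= 2 ^ b')%N by rewrite leq_exp2l.
  have h2 : (2 ^ a < 2 ^ b)%N by rewrite ltn_exp2l.
  have h3 : (0 < 2 ^ a')%N by rewrite expn_gt0.
  by rewrite expnS in h1; lia.
have kk : k = k'.
  case: (ltngtP k k') => // kk; first by case: (aux _ _ _ _ ik ik' h kk).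
  by case: (aux _ _ _ _ ik' ik (esym h) kk).
move: h; rewrite kk => /addIn /eqP; rewrite eqn_exp2l // => /eqP ->.
by rewrite eqxx.
Qed.

(** The difference of the two forms at [a + s * z] is a polynomial in [s] which
    vanishes except for the finitely many [s] where [a + s * z] is not generic;
    so it also vanishes at [s = 0]. *)
Lemma star_core a i0 k0 :
  iter d (jshift (pt a)) (J i0) [::] = iter d (jshift (pt a)) (J k0) [::].
Proof.
pose z (l : 'I_N.+1) : R := (2 ^ l)%:R.
(* With [b = z ^ 2] the genericity condition has leading coefficient in [s] a
   multiple of [(z i' + z k') - (z i + z k)]. *)
pose b l := z l ^+ 2.
have z_inj : injective z.
  move=> i k /eqP; rewrite eqr_nat eqn_exp2l // => /eqP h; exact: val_inj.
have z_gt0 l : 0 < z l by rewrite ltr0n expn_gt0.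
have b_inj : injective b.
  move=> i k /eqP; rewrite eqf_sqr => /orP[/eqP/z_inj//|].
  by rewrite -addr_eq0 gt_eqF // addr_gt0.
pose f1 (q : 'I_N.+1 * 'I_N.+1) : {poly R} := (a q.1 - a q.2)%:P + (z q.1 - z q.2) *: 'X.
pose f2 (q : ('I_N.+1 * 'I_N.+1) * ('I_N.+1 * 'I_N.+1)) : {poly R} :=
  (b q.2.1 - b q.2.2) *: f1 q.1 - (b q.1.1 - b q.1.2) *: f1 q.2.
(* The [s] for which [a + s * z] is not generic are the roots of [bad]. *)
pose bad := (\prod_(q | q.1 != q.2) f1 q) *
  \prod_(q : ('I_N.+1 * 'I_N.+1) * ('I_N.+1 * 'I_N.+1) |
    [&& (q.1.1 < q.1.2)%N, (q.2.1 < q.2.2)%N & q.1 != q.2]) f2 q.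
have f1_neq0 q : q.1 != q.2 -> f1 q != 0.
  move=> ne; apply/negP => /eqP /(congr1 (fun p : {poly R} => p`_1)).
  rewrite coefD coefC coefZ coefX coef0 /= add0r mulr1 => /eqP; rewrite subr_eq0.
  by move=> /eqP /z_inj h; rewrite h eqxx in ne.
have bad0 : bad != 0.
  rewrite mulf_neq0 //; first by apply/prodf_neq0 => q; apply: f1_neq0.
  apply/prodf_neq0 => -[[i k] [i' k']] /= /and3P[ik ik' ne].
  apply/negP => /eqP /(congr1 (fun p : {poly R} => p`_1)).
  rewrite coefB !coefZ !coefD !coefC !coefZ !coefX ?coef0 /= !add0r !mulr1.
  have -> : (b i' - b k') * (z i - z k) - (b i - b k) * (z i' - z k') =
      (z i - z k) * (z i' - z k') * ((z i' + z k') - (z i + z k)).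
    by rewrite /b; ring.
  apply/eqP; rewrite !mulf_neq0 ?subr_eq0 //.
  - by apply: contraTneq ik => /z_inj ->; rewrite ltnn.
  - by apply: contraTneq ik' => /z_inj ->; rewrite ltnn.
  - by rewrite -!natrD eqr_nat pow2_sidon // eq_sym.
pose U : 'rV[{poly R}]_n := map_mx polyC (pt a) + 'X *: map_mx polyC (\sum_l z l *: E l).
pose Q := iter d (jshift U) (polyC \o J i0) [::] - iter d (jshift U) (polyC \o J k0) [::].
have QE s : Q.[s] = iter d (jshift (pt (fun l => a l + s * z l))) (J i0) [::] -
   iter d (jshift (pt (fun l => a l + s * z l))) (J k0) [::].
  rewrite -[LHS]/(horner_eval s _) rmorphB /= !jshift_map.
  have -> : map_mx (horner_eval s) U = pt (fun l => a l + s * z l).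
    apply/rowP=> j; rewrite !mxE /= /horner_eval !hornerE /=.
    rewrite -addrA; congr (_ + _); rewrite !summxE mulr_sumr -big_split.
    by apply: eq_bigr => l _; rewrite !mxE /= mulrDl mulrA.
  have C l : horner_eval s \o (polyC \o J l) = J l.
    by apply/funext => w; rewrite /= /horner_eval hornerC.
  by rewrite !C.
have : Q * bad = 0.
  apply: poly_all_root => s; rewrite hornerM.
  have [->|bs] := eqVneq bad.[s] 0; first by rewrite mulr0.
  suff -> : Q.[s] = 0 by rewrite mul0r.
  move: bs; rewrite hornerM mulf_eq0 negb_or !horner_prod.
  move=> /andP[/prodf_neq0 h1 /prodf_neq0 h2].
  have f1E q : (f1 q).[s] = (a q.1 + s * z q.1) - (a q.2 + s * z q.2).
    by rewrite !hornerE /=; ring.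
  rewrite QE; apply/eqP; rewrite subr_eq0; apply/eqP/(star_line (b := b)) => //.
    move=> i k e; apply/eqP; apply: contraT => ik.
    by have := h1 (i, k) ik; rewrite f1E e subrr eqxx.
  move=> i k i' k' ik ik' ne.
  have := h2 ((i, k), (i', k')); rewrite /= ik ik' ne => /(_ isT).
  by rewrite /f2 hornerD hornerN !hornerZ !f1E /= subr_eq0.
move/eqP; rewrite mulf_eq0 (negPf bad0) orbF => /eqP Q0.
have := QE 0; rewrite Q0 horner0 => /esym /eqP; rewrite subr_eq0 => /eqP.
have -> : (fun l => a l + 0 * z l) = a by apply/funext => l; rewrite mul0r addr0.
by [].
Qed.

End Star.

Local Open Scope classical_set_scope.
Local Open Scope ring_scope.

(** * Directional derivatives *)

Section Directional.
Variables (R : realType) (V : normedModType R).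
Implicit Types (f g G : V -> R) (x y u e : V).

Lemma is_derive_eps x u g l : is_derive x u g l <->
  forall eps : R, 0 < eps -> exists2 del : R, 0 < del & forall h : R, h != 0 -> `|h| < del ->
    `|l - h^-1 * (g (h *: u + x) - g x)| < eps.
Proof.
have E : ((fun h => h^-1 *: ((g \o shift x) (h *: u) - g x)) @ 0^' --> l) <->
  forall eps : R, 0 < eps -> exists2 del : R, 0 < del & forall h : R, h != 0 -> `|h| < del ->
    `|l - h^-1 * (g (h *: u + x) - g x)| < eps.
  split=> [/cvgrPdist_lt H eps e0|H].
    have := H _ e0; rewrite /dnbhs /within /= => /nbhs_ballP[del d0 Hd].
    by exists del => // h h0 hd; apply: Hd => //; rewrite -ball_normE /= sub0r normrN.
  apply/cvgrPdist_lt => eps e0; have [del d0 Hd] := H _ e0.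
  rewrite /dnbhs /within /=; apply/nbhs_ballP; exists del => // h.
  by rewrite -ball_normE /= sub0r normrN => hd h0; apply: Hd.
rewrite -E; split=> [[dg <-]|H]; first exact: dg.
by apply: DeriveDef; [apply/cvg_ex; exists l|apply: cvg_lim].
Qed.

Lemma continuous_eps x G : {for x, continuous G} -> forall eps : R, 0 < eps ->
  exists2 del : R, 0 < del & forall y, `|y - x| < del -> `|G y - G x| < eps.
Proof.
move=> /cvgrPdist_lt H eps e0; have /nbhs_ballP[del d0 Hd] := H _ e0.
exists del => // y yx; rewrite distrC; apply: Hd.
by rewrite -ball_normE /= distrC.
Qed.

Lemma open_eps (U : set V) x : open U -> U x ->
  exists2 del : R, 0 < del & forall y, `|y - x| < del -> U y.
Proof.
move=> oU Ux; have /nbhs_ballP[del d0 Hd] := open_nbhs_nbhs (conj oU Ux).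
by exists del => // y yx; apply: Hd; rewrite -ball_normE /= distrC.
Qed.

Lemma is_derive_line g y e s l :
  is_derive (y + s *: e) e g l <-> is_derive s 1 (fun t => g (y + t *: e)) l.
Proof.
have E : (fun h : R => h^-1 *: ((g \o shift (y + s *: e)) (h *: e) - g (y + s *: e))) =
  (fun h : R => h^-1 *: (((fun t => g (y + t *: e)) \o shift s) (h *: 1) -
     g (y + s *: e))).
  apply/funext => h /=; congr (_ *: (g _ - _)).
  by rewrite [_%:A]mulr1 scalerDl addrCA.
split=> -[d <-]; apply: DeriveDef; rewrite /derivable /derive.
- by rewrite -E.
- by rewrite -E.
- by rewrite E.
- by rewrite E.
Qed.

Lemma is_derive_translate g y k e l :
  is_derive (y + k) e g l -> is_derive y e (fun z => g (z + k)) l.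
Proof.
have E : (fun h : R => h^-1 *: ((g \o shift (y + k)) (h *: e) - g (y + k))) =
  (fun h : R => h^-1 *: (((fun z => g (z + k)) \o shift y) (h *: e) - g (y + k))).
  by apply/funext => h /=; rewrite addrA.
by move=> -[d <-]; apply: DeriveDef; rewrite /derivable /derive -E.
Qed.

Lemma mvt_dir g G y e (k : R) :
  (forall s : R, 0 <= s <= 1 -> is_derive (y + (s * k) *: e) e g (G (y + (s * k) *: e))) ->
  exists2 s : R, 0 <= s <= 1 & g (y + k *: e) - g y = k * G (y + (s * k) *: e).
Proof.
move=> H.
pose phi (s : R) := g (y + (s * k) *: e).
have dphi (s : R) : 0 <= s <= 1 -> is_derive s 1 phi (G (y + (s * k) *: e) * k).
  move=> /H /is_derive_line hs.
  have hk : is_derive s 1 (fun s : R => s * k) k.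
    have := @is_deriveM R R id (cst k) s 1 1 0 (is_derive_id _ _) (is_derive_cst _ _ _).
    by move/is_derive_eq; apply; rewrite scaler0 add0r [_%:A]mulr1.
  exact: (@is_derive1_comp R (fun t => g (y + t *: e)) (fun s => s * k) s _ _ hs hk).
have [||s ss q] := @MVT_segment R phi (fun s : R => G (y + (s * k) *: e) * k) 0 1 ler01.
- by move=> s; rewrite in_itv /= => /andP[s0 s1]; apply: dphi; rewrite !ltW.
- apply: derivable_within_continuous => s; rewrite in_itv /= => s01.
  exact: (@ex_derive _ _ _ _ _ _ _ (dphi s s01)).
exists s; first by move: ss; rewrite in_itv.
move: q; rewrite /phi mul1r mul0r scale0r addr0 subr0 mulr1 => ->.
by rewrite mulrC.
Qed.


Lemma norm_comb_lt (u e : V) (h a b del : R) :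
  0 < del -> `|h| < del / (`|u| + `|e| + 1) -> `|a| <= 1 -> `|b| <= 1 ->
  `|(a * h) *: u + (b * h) *: e| < del.
Proof.
move=> d0 hh a1 b1.
have K0 : 0 < `|u| + `|e| + 1 by rewrite ltr_wpDl ?addr_ge0.
have hh' : `|h| * (`|u| + `|e| + 1) < del by rewrite -ltr_pdivlMr.
apply: (le_lt_trans (ler_normD _ _)); rewrite !normrZ.
have hu : `|a| * `|h| * `|u| <= `|h| * `|u| by rewrite ler_wpM2r // ler_piMl.
have he : `|b| * `|h| * `|e| <= `|h| * `|e| by rewrite ler_wpM2r // ler_piMl.
apply: (le_lt_trans (lerD hu he)); apply: le_lt_trans hh'.
by rewrite -mulrDr ler_wpM2l // lerDl.
Qed.

(** The increment of [g] is the increment along [u] followed by one along [e],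
    which is a mean value of [G] near [x]. *)
Lemma is_derive_addl g G x u e (c l del : R) : 0 < del ->
  is_derive x u g l -> (forall y, `|y - x| < del -> is_derive y e g (G y)) ->
  {for x, continuous G} -> is_derive x (u + c *: e) g (l + c * G x).
Proof.
move=> d0 /is_derive_eps Hu He /continuous_eps HG; apply/is_derive_eps => eps e0.
have c0 : 0 < `|c| + 1 by rewrite ltr_wpDl.
have [d1 d10 Hd1] := Hu _ (divr_gt0 e0 (ltr0n R 2)).
have [d2 d20 Hd2] := HG (eps / 2 / (`|c| + 1)) (divr_gt0 (divr_gt0 e0 (ltr0n R 2)) c0).
pose K := `|u| + `|c *: e| + 1.
have K0 : 0 < K by rewrite ltr_wpDl ?addr_ge0.
exists (Num.min d1 (Num.min (del / K) (d2 / K))).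
  by rewrite !lt_min d10 !divr_gt0.
move=> h h0; rewrite !lt_min => /and3P[hd1 hd hd2].
have near_x d (s : R) : 0 < d -> `|h| < d / K -> 0 <= s <= 1 ->
    `|h *: u + x + (s * (h * c)) *: e - x| < d.
  move=> dp hdk /andP[s0 s1].
  have -> : h *: u + x + (s * (h * c)) *: e - x = (1 * h) *: u + (s * h) *: (c *: e).
    by rewrite mul1r scalerA mulrA addrAC addrK.
  by apply: norm_comb_lt; rewrite ?normr1 ?(ger0_norm s0) ?lexx.
have [s s01 hs] := @mvt_dir g G (h *: u + x) e (h * c)
  (fun s s01 => He _ (near_x _ s d0 hd s01)).
have -> : h *: (u + c *: e) + x = h *: u + x + (h * c) *: e.
  by rewrite scalerDr scalerA addrAC.
set y := h *: u + x + (s * (h * c)) *: e in hs.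
have -> : l + c * G x - h^-1 * (g (h *: u + x + (h * c) *: e) - g x) =
   (l - h^-1 * (g (h *: u + x) - g x)) - c * (G y - G x).
  have -> : g (h *: u + x + (h * c) *: e) - g x =
     h * c * G y + (g (h *: u + x) - g x) by rewrite -hs; ring.
  by field.
apply: (le_lt_trans (ler_normB _ _)); rewrite [ltRHS](splitr eps).
apply: ltr_leD; first exact: Hd1.
rewrite normrM; have := ltW (Hd2 y (near_x _ _ d20 hd2 s01)).
rewrite ler_pdivlMr // => H; apply: le_trans H.
by rewrite mulrC ler_wpM2l // lerDl.
Qed.

(** The mean value theorem is applied along [ei] to the increments of [f] in the
    direction [ej], and then along [ej]. *)
Lemma second_diff (f F G : V -> R) x ei ej (h del : R) : 0 < del ->
  (forall y, `|y - x| < del -> is_derive y ei f (F y)) ->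
  (forall y, `|y - x| < del -> is_derive y ej F (G y)) ->
  `|h| < del / (`|ei| + `|ej| + 1) ->
  exists2 y, `|y - x| < del & f (x + h *: ei + h *: ej) - f (x + h *: ei) -
    (f (x + h *: ej) - f x) = h * (h * G y).
Proof.
move=> d0 HF HG hd.
have near_x (s t : R) : 0 <= s <= 1 -> 0 <= t <= 1 ->
    `|x + (s * h) *: ei + (t * h) *: ej - x| < del.
  move=> /andP[s0 s1] /andP[t0 t1].
  have -> : x + (s * h) *: ei + (t * h) *: ej - x = (s * h) *: ei + (t * h) *: ej.
    by rewrite addrC addrA addKr.
  by apply: norm_comb_lt; rewrite ?(ger0_norm s0) ?(ger0_norm t0).
have unit0 : 0 <= (0 : R) <= 1 by rewrite lexx ler01.
have unit1 : 0 <= (1 : R) <= 1 by rewrite lexx ler01.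
have near_i (s : R) : 0 <= s <= 1 -> `|x + (s * h) *: ei - x| < del.
  by move=> /near_x/(_ unit0); rewrite mul0r scale0r addr0.
have near_ij (s : R) : 0 <= s <= 1 -> `|x + (s * h) *: ei + h *: ej - x| < del.
  by move=> /near_x/(_ unit1); rewrite mul1r.
have [s s01 hs] := @mvt_dir (fun y => f (y + h *: ej) - f y)
   (fun y => F (y + h *: ej) - F y) x ei h (fun s s01 =>
   @is_deriveB _ _ _ (fun y => f (y + h *: ej)) f _ _ _ _
     (is_derive_translate (HF _ (near_ij s s01))) (HF _ (near_i s s01))).
have [t t01 ht] := @mvt_dir F G (x + (s * h) *: ei) ej h
  (fun t t01 => HG _ (near_x s t s01 t01)).
exists (x + (s * h) *: ei + (t * h) *: ej); first exact: near_x.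
by rewrite -ht -hs.
Qed.

(** The second difference is symmetric in the two directions, so both mixed
    derivatives take equal values arbitrarily close to [x]. *)
Lemma schwarz (f Fi Fj Gij Gji : V -> R) x ei ej (del : R) : 0 < del ->
  (forall y, `|y - x| < del -> is_derive y ei f (Fi y)) ->
  (forall y, `|y - x| < del -> is_derive y ej f (Fj y)) ->
  (forall y, `|y - x| < del -> is_derive y ej Fi (Gij y)) ->
  (forall y, `|y - x| < del -> is_derive y ei Fj (Gji y)) ->
  {for x, continuous Gij} -> {for x, continuous Gji} -> Gij x = Gji x.
Proof.
move=> d0 Hi Hj Hij Hji /continuous_eps cij /continuous_eps cji.
apply/eqP; rewrite -subr_eq0 -normr_le0; apply/ler_addgt0Pl => eps e0.
rewrite addr0; have e2 := divr_gt0 e0 (ltr0n R 2).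
have [d1 d10 h1] := cij _ e2; have [d2 d20 h2] := cji _ e2.
pose dd := Num.min del (Num.min d1 d2).
have dd0 : 0 < dd by rewrite !lt_min d0 d10 d20.
pose K := `|ei| + `|ej| + 1.
have K0 : 0 < K by rewrite ltr_wpDl ?addr_ge0.
pose h := dd / K / 2.
have h0 : 0 < h by rewrite !divr_gt0.
have hd : `|h| < dd / K by rewrite gtr0_norm // /h ltr_pdivrMr // ltr_pMr ?divr_gt0 // ltr1n.
have ddel y : `|y - x| < dd -> `|y - x| < del by rewrite !lt_min => /and3P[].
have [y yx hy] := second_diff dd0 (fun y yx => Hi y (ddel y yx))
  (fun y yx => Hij y (ddel y yx)) hd.
have hd' : `|h| < dd / (`|ej| + `|ei| + 1) by rewrite [ `|ej| + _]addrC.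
have [z zx hz] := second_diff dd0 (fun y yx => Hj y (ddel y yx))
  (fun y yx => Hji y (ddel y yx)) hd'.
have yz : Gij y = Gji z.
  apply: (mulfI (lt0r_neq0 h0)); apply: (mulfI (lt0r_neq0 h0)); rewrite -hy -hz.
  by rewrite [x + h *: ej + _]addrAC; ring.
have -> : Gij x - Gji x = (Gji z - Gji x) - (Gij y - Gij x) by rewrite yz; ring.
apply: (le_trans (ler_normB _ _)); rewrite [leRHS](splitr eps); apply: lerD.
  by apply/ltW/h2; move: zx; rewrite !lt_min => /and3P[].
by apply/ltW/h1; move: yx; rewrite !lt_min => /and3P[].
Qed.

End Directional.

(** * Jets of smooth functions *)

Section Smooth.
Context {R : realType} {n : nat}.
Local Notation V := 'rV[R]_n.
Implicit Types (f g : V -> R) (x y u v : V) (w : seq 'I_n) (U : set V).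

Definition jet f x : seq 'I_n -> R := fun w => pderives w f x.

Lemma near_open U x (P : V -> Prop) : open U -> U x -> (forall y, U y -> P y) ->
  \near x, P x.
Proof.
move=> oU Ux UP; apply: filterS (open_nbhs_nbhs (conj oU Ux)); exact: UP.
Qed.

Lemma eq_pderive U i f g : open U -> (forall x, U x -> f x = g x) ->
  forall x, U x -> pderive i f x = pderive i g x.
Proof.
by move=> oU fg x Ux; apply: near_eq_derive; apply: near_open fg.
Qed.

Lemma smooth_pderive U f : smooth_on U f -> forall w i x, U x ->
  is_derive x 'e_i (pderives w f) (pderives (i :: w) f x).
Proof. by move=> sf w i x Ux; apply: derivableP; apply: (sf w x Ux).2. Qed.

(** Continuity of the partial derivatives allows the coordinates of the direction
    to be added one at a time. *)
Lemma smooth_directional U f : open U -> smooth_on U f -> forall w u x, U x ->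
  is_derive x u (pderives w f) (\sum_i u 0 i * pderives (i :: w) f x).
Proof.
move=> oU sf w u x Ux; rewrite {1}[u]row_sum_delta.
have [del d0 hd] := open_eps oU Ux.
elim: (index_enum _) => [|i l IH].
  by rewrite !big_nil; apply: is_derive0.
rewrite !big_cons [X in is_derive _ X _ _]addrC [X in is_derive _ _ _ X]addrC.
apply: (is_derive_addl (G := pderives (i :: w) f) _ d0 IH) => [y /hd Uy|].
  exact: (smooth_pderive sf).
exact: (sf (i :: w) x Ux).1.
Qed.

Lemma jet_swap U f : open U -> smooth_on U f -> forall w i j x, U x ->
  pderives (i :: j :: w) f x = pderives (j :: i :: w) f x.
Proof.
move=> oU sf w i j x Ux; have [del d0 hd] := open_eps oU Ux.
apply: (@schwarz R V (pderives w f) (pderives (j :: w) f) (pderives (i :: w) f)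
  (pderives [:: i, j & w] f) (pderives [:: j, i & w] f) x 'e_j 'e_i del d0).
- by move=> y /hd; apply: (smooth_pderive sf).
- by move=> y /hd; apply: (smooth_pderive sf).
- by move=> y /hd; apply: (smooth_pderive sf).
- by move=> y /hd; apply: (smooth_pderive sf).
- exact: (sf _ x Ux).1.
- exact: (sf _ x Ux).1.
Qed.

(** Adjacent transpositions bring any letter to the front of a word. *)
Lemma jet_sym U f x : open U -> smooth_on U f -> U x -> jsym (jet f x).
Proof.
move=> oU sf Ux w w'; rewrite /jet; elim: w w' x Ux => [|i w IH] w' x Ux.
  by rewrite perm_sym => /perm_nilP ->.
have front a b y : U y -> pderives (a ++ i :: b) f y = pderives (i :: a ++ b) f y.
  elim: a y => [//|j a IHa] y Uy.
  by rewrite [RHS](jet_swap oU sf (a ++ b) i j Uy); apply: (eq_pderive j oU IHa).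
move=> ww; have iw : i \in w' by rewrite -(perm_mem ww) mem_head.
case/path.splitPr: iw ww => a b ww; rewrite front //=.
apply: (@eq_pderive U i _ _ oU) => // y Uy; apply: IH => //.
by move: ww; rewrite perm_sym perm_catC /= perm_cons perm_catC perm_sym.
Qed.

Lemma jet_line U f : open U -> smooth_on U f -> forall e w x u (s : R), U (x + s *: u) ->
  is_derive s 1 (fun t => iter e (jshift u) (jet f (x + t *: u)) w)
    (iter e.+1 (jshift u) (jet f (x + s *: u)) w).
Proof.
move=> oU sf; elim=> [|e IH] w x u s Us.
  exact: (iffLR (is_derive_line (pderives w f) x u s _) (smooth_directional oU sf w u Us)).
have -> : (fun t => iter e.+1 (jshift u) (jet f (x + t *: u)) w) =
    \sum_i (fun t : R => u 0 i * iter e (jshift u) (jet f (x + t *: u)) (i :: w)).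
  by apply/funext => t; rewrite fct_sumE.
apply: is_derive_sum => i.
exact: (@is_deriveZ _ _ _ _ (u 0 i) _ _ _ (IH (i :: w) x u s Us)).
Qed.

Lemma derive_zero_right (phi : R -> R) (s l del : R) : 0 < del ->
  (forall t, s <= t < s + del -> phi t = 0) -> is_derive s 1 phi l -> l = 0.
Proof.
move=> d0 h0 /is_derive_eps H; apply/eqP; rewrite -normr_le0.
apply/ler_addgt0Pl => eps e0; rewrite addr0.
have [d1 d10 hd1] := H _ e0.
pose h := Num.min d1 del / 2.
have hp : 0 < h by rewrite divr_gt0 // lt_min d10.
have hm : h < Num.min d1 del by rewrite /h ltr_pdivrMr // ltr_pMr ?ltr1n // lt_min d10.
move: hm; rewrite lt_min => /andP[hd hdel].
have := hd1 h (lt0r_neq0 hp); rewrite gtr0_norm // => /(_ hd).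
rewrite [h *: 1]mulr1 !h0 ?subr0 ?mulr0 ?subr0; first exact: ltW.
  by rewrite lexx ltrDl.
by rewrite lerDr ltW //= addrC ltrD2l.
Qed.

(** Each form vanishes on a half-open segment, so the next one, its derivative
    along the segment, vanishes there too; derivatives from the right suffice,
    which includes the end point [x]. *)
Lemma jet_segment U f : open U -> smooth_on U f -> forall w x u (del : R), 0 < del ->
  (forall s, 0 <= s < del -> U (x + s *: u) /\ pderives w f (x + s *: u) = 0) ->
  forall e, iter e (jshift u) (jet f x) w = 0.
Proof.
move=> oU sf w x u del d0 h e.
suff H s : 0 <= s < del -> iter e (jshift u) (jet f (x + s *: u)) w = 0.
  by have := H 0; rewrite scale0r addr0; apply; rewrite lexx.
elim: e s => [|e IH] s hs; first by have [] := h s hs.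
apply: (derive_zero_right (s := s) (del := del - s) (phi := fun t =>
  iter e (jshift u) (jet f (x + t *: u)) w)).
- by case/andP: hs => _; rewrite subr_gt0.
- move=> t /andP[st td]; apply: IH; case/andP: hs => s0 _.
  by rewrite (le_trans s0 st) /=; move: td; rewrite addrC subrK.
- by apply: (jet_line oU) => //; have [] := h s hs.
Qed.

Lemma smooth_sub (U U' : set V) f : U' `<=` U -> smooth_on U f -> smooth_on U' f.
Proof. by move=> UU sf w x /UU; apply: sf. Qed.

Lemma pderivesB U f g : open U -> smooth_on U f -> smooth_on U g ->
  forall w x, U x -> pderives w (f - g) x = pderives w f x - pderives w g x.
Proof.
move=> oU sf sg; elim=> [//|i w IH] x Ux.
rewrite /= (eq_pderive i oU IH Ux).
exact: (@derive_val _ _ _ _ _ _ _ (@is_deriveB _ _ _ _ _ _ _ _ _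
  (smooth_pderive sf w i Ux) (smooth_pderive sg w i Ux))).
Qed.

Lemma smoothB U f g : open U -> smooth_on U f -> smooth_on U g -> smooth_on U (f - g).
Proof.
move=> oU sf sg w x Ux.
have E : \near x, pderives w f x - pderives w g x = pderives w (f - g) x.
  by apply: (near_open oU Ux) => y Uy; rewrite (pderivesB oU).
split.
  have e0 := pderivesB oU sf sg w Ux; rewrite /prop_for /continuous_at e0.
  apply: cvg_trans; first exact: (near_eq_cvg E).
  apply: cvgB; [exact: (sf w x Ux).1|exact: (sg w x Ux).1].
move=> i; apply: (near_eq_derivable E).
by apply: derivableB; [exact: (sf w x Ux).2|exact: (sg w x Ux).2].
Qed.

(** Multi-indices only give access to the words sorted by coordinate; by symmetry
    every word is accounted for by the one with the same letters. *)
Definition mi_of (w : seq 'I_n) : {ffun 'I_n -> nat} := [ffun i => count_mem i w].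

Lemma mi_word (a : {ffun 'I_n -> nat}) :
  size (flatten [seq nseq (a i) i | i <- enum 'I_n]) = mi_order a.
Proof.
rewrite size_flatten /shape -map_comp /mi_order sumnE big_map big_enum /=.
by apply: eq_bigr => i _; rewrite size_nseq.
Qed.

Lemma mi_of_perm w : perm_eq (flatten [seq nseq (mi_of w i) i | i <- enum 'I_n]) w.
Proof.
apply/allP => j _ /=; rewrite count_flatten -map_comp sumnE big_map big_enum /=.
rewrite (bigD1 j) //= count_nseq /= eqxx mul1n ffunE big1 ?addn0 // => i ij.
by rewrite count_nseq /= (negPf ij).
Qed.

Lemma mi_of_order w : mi_order (mi_of w) = size w.
Proof. by rewrite -mi_word (perm_size (mi_of_perm w)). Qed.

Lemma mi_derive_jet U f x w : open U -> smooth_on U f -> U x ->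
  mi_derive (mi_of w) f x = jet f x w.
Proof. by move=> oU sf Ux; apply: (jet_sym oU sf Ux (mi_of_perm w)). Qed.

End Smooth.

Lemma poly_itv_root (R : realType) (p : {poly R}) (eps : R) : 0 < eps ->
  (forall s, 0 <= s <= eps -> p.[s] = 0) -> p = 0.
Proof.
move=> e0 h; apply/eqP/negPn/negP => p0.
have := @max_poly_roots _ p [seq eps / i.+1%:R | i <- iota 0 (size p)] p0.
rewrite size_map size_iota ltnn => H; suff: false by []; apply: H.
  apply/allP=> _ /mapP[i _ ->]; apply/rootP/h.
  apply/andP; split; first by rewrite divr_ge0 // ltW.
  by rewrite ler_pdivrMr ?ltr0n // ler_pMr // ler1n.
rewrite map_inj_uniq ?iota_uniq // => i j /(mulfI (lt0r_neq0 e0)) /invr_inj /eqP.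
by rewrite eqr_nat eqSS => /eqP.
Qed.

(** A Taylor form is polynomial in the direction, so that its zeros on a segment
    propagate to the whole line. *)
Lemma jshift_extend (R : realType) n (J : seq 'I_n -> R) (u0 u1 : 'rV[R]_n) (eps : R) e w :
  0 < eps ->
  (forall s, 0 <= s <= eps -> iter e (jshift (u1 + s *: (u0 - u1))) J w = 0) ->
  iter e (jshift u0) J w = 0.
Proof.
move=> e0 h.
pose U : 'rV[{poly R}]_n := map_mx polyC u1 + 'X *: map_mx polyC (u0 - u1).
have E s : (iter e (jshift U) (polyC \o J) w).[s] =
    iter e (jshift (u1 + s *: (u0 - u1))) J w.
  rewrite -[LHS]/(horner_eval s _) jshift_map.
  have -> : map_mx (horner_eval s) U = u1 + s *: (u0 - u1).
    by apply/rowP=> j; rewrite !mxE /= /horner_eval !hornerE.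
  by congr (iter e _ _ _); apply/funext => w'; rewrite /= /horner_eval hornerC.
have : iter e (jshift U) (polyC \o J) w = 0.
  by apply: (poly_itv_root e0) => s hs; rewrite E h.
by move=> /(congr1 (fun p : {poly R} => p.[1])); rewrite E scale1r addrC subrK horner0.
Qed.

(** The directions from [v] into [K] only fill a cone; [u1] is a direction inside
    this cone, and [u0] any direction in its span. *)
Lemma facet_vanish (R : realType) n (U K : set 'rV[R]_n) f v r (u0 u1 : 'rV[R]_n) (eps : R) :
  open U -> smooth_on U f -> K `<=` U ->
  (forall x w, K x -> (size w <= r)%N -> pderives w f x = 0) ->
  0 < eps ->
  (forall s t, 0 <= s <= eps -> 0 <= t <= 1 -> K (v + t *: (u1 + s *: (u0 - u1)))) ->
  forall e w, (size w <= r)%N -> iter e (jshift u0) (jet f v) w = 0.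
Proof.
move=> oU sf KU hK e0 hseg e w wr; apply: (jshift_extend e0) => s hs.
apply: (jet_segment oU sf (del := 1)) => // t /andP[t0 t1].
have Kt : K (v + t *: (u1 + s *: (u0 - u1))) by apply: hseg => //; rewrite t0 ltW.
by split; [exact: (KU _ Kt)|exact: (hK _ _ Kt wr)].
Qed.

(** * Polynomial functions *)

Section PolyFun.
Context {R : realType} {n : nat}.
Local Notation V := 'rV[R]_n.
Implicit Types (f g h : V -> R) (x y u v : V) (w : seq 'I_n).

Inductive polyfun : (V -> R) -> Prop :=
| polyfun_cst c : polyfun (fun=> c)
| polyfun_coord i : polyfun (fun y => y 0 i)
| polyfunD f g : polyfun f -> polyfun g -> polyfun (fun y => f y + g y)
| polyfunM f g : polyfun f -> polyfun g -> polyfun (fun y => f y * g y).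

Lemma polyfun_sum (I : Type) (r : seq I) (F : I -> V -> R) :
  (forall i, polyfun (F i)) -> polyfun (fun y => \sum_(i <- r) F i y).
Proof.
move=> hF; elim: r => [|i r IH].
  have -> : (fun y => \sum_(i <- [::]) F i y) = (fun=> 0).
    by apply/funext => y; rewrite big_nil.
  exact: polyfun_cst.
have -> : (fun y => \sum_(j <- i :: r) F j y) = (fun y => F i y + \sum_(j <- r) F j y).
  by apply/funext => y; rewrite big_cons.
exact: polyfunD.
Qed.

Lemma polyfunB f g : polyfun f -> polyfun g -> polyfun (fun y => f y - g y).
Proof.
move=> hf hg.
have -> : (fun y => f y - g y) = (fun y => f y + -1 * g y).
  by apply/funext => y; rewrite mulN1r.
by apply/polyfunD => //; apply: polyfunM => //; apply: polyfun_cst.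
Qed.

Lemma polyfun_is_derive f i : polyfun f ->
  exists2 g, polyfun g & forall y, is_derive y 'e_i f (g y).
Proof.
elim=> {f} [c|j|f g _ [f' pf' hf] _ [g' pg' hg]|f g pf [f' pf' hf] pg [g' pg' hg]].
- by exists (fun=> 0); [exact: polyfun_cst|move=> y; exact: is_derive_cst].
- exists (fun=> ('e_i : V) 0 j); first exact: polyfun_cst.
  move=> y; apply/is_derive_eps => eps e0; exists 1 => // h h0 _.
  by rewrite !mxE addrK mulKf // subrr normr0.
- exists (fun y => f' y + g' y); first exact: polyfunD.
  by move=> y; apply: is_deriveD.
- exists (fun y => f y * g' y + g y * f' y).
    by apply: polyfunD; apply: polyfunM.
  by move=> y; apply: (@is_deriveM _ _ f g).
Qed.

Lemma polyfun_pderive f i : polyfun f -> polyfun (pderive i f).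
Proof.
move=> /(polyfun_is_derive i)[g pg hg].
by have -> : pderive i f = g by apply/funext => y; apply: (@derive_val _ _ _ _ _ _ _ (hg y)).
Qed.

Lemma polyfun_continuous f : polyfun f -> continuous f.
Proof.
elim=> {f} [c|j|f g _ hf _ hg|f g _ hf _ hg] x.
- exact: cst_continuous.
- exact: coord_continuous.
- by apply: continuousD; [apply: hf|apply: hg].
- by apply: continuousM; [apply: hf|apply: hg].
Qed.

Lemma polyfun_smooth f : polyfun f -> smooth_on setT f.
Proof.
move=> pf w x _; have pw : polyfun (pderives w f).
  by elim: w => //= i w IH; apply: polyfun_pderive.
split; first exact: polyfun_continuous.
by move=> i; have [g _ hg] := polyfun_is_derive i pw; apply: (@ex_derive _ _ _ _ _ _ _ (hg x)).
Qed.

(** Each differentiation costs at most one power of [l]. *)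
Lemma polyfun_vanish (l : V -> R) h m w x : polyfun l -> polyfun h ->
  (size w < m)%N -> l x = 0 -> pderives w (fun y => l y ^+ m * h y) x = 0.
Proof.
move=> pl ph wm lx.
suff [h' _ ->] : exists2 h', polyfun h' &
    pderives w (fun y => l y ^+ m * h y) = (fun y => l y ^+ (m - size w) * h' y).
  by rewrite lx expr0n subn_eq0 leqNgt wm mul0r.
elim: w wm => [|i w IH] /= wm; first by exists h; rewrite ?subn0.
have [h' ph' ->] := IH (ltnW wm).
have -> : (m - size w = (m - (size w).+1).+1)%N by lia.
set k := (m - (size w).+1)%N.
have [l' pl' hl] := polyfun_is_derive i pl; have [h2 ph2 hh] := polyfun_is_derive i ph'.
exists (fun y => k.+1%:R * l' y * h' y + l y * h2 y).
  by apply: polyfunD; apply: polyfunM => //; apply: polyfunM => //; apply: polyfun_cst.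
apply/funext => y.
have := @is_deriveM _ _ _ _ _ _ _ _ (@is_deriveX _ _ _ k.+1 _ _ _ (hl y)) (hh y).
have -> : (l ^+ k.+1 * h') = (fun y => l y ^+ k.+1 * h' y).
  by apply/funext => z; rewrite mulrfctE exprfctE.
move=> dl; rewrite /pderive (@derive_val _ _ _ _ _ _ _ dl) exprfctE.
rewrite /GRing.scale /= !exprS -mulr_natl; ring.
Qed.

Lemma jet_poly_line f v u (P : {poly R}) : smooth_on setT f ->
  (forall s, f (v + s *: u) = P.[s]) ->
  forall e, iter e (jshift u) (jet f v) [::] = P^`(e).[0].
Proof.
move=> sf hP e.
suff H s : iter e (jshift u) (jet f (v + s *: u)) [::] = P^`(e).[s].
  by rewrite -H scale0r addr0.
elim: e s => [|e IH] s; first exact: hP.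
have h1 := jet_line openT sf e [::] (I : setT (v + s *: u)).
have E : (fun t => iter e (jshift u) (jet f (v + t *: u)) [::]) = horner P^`(e).
  exact/funext.
rewrite E in h1.
rewrite -(@derive_val _ _ _ _ _ _ _ h1) derivnS.
exact: (@derive_val _ _ _ _ _ _ _ (is_derive_poly _ _)).
Qed.

Lemma homogeneous_jet f v u D c : smooth_on setT f ->
  (forall s, f (v + s *: u) = s ^+ D * c) ->
  iter D (jshift u) (jet f v) [::] = D`!%:R * c.
Proof.
move=> sf h.
rewrite (@jet_poly_line f v u (c *: 'X^D)) //.
  by rewrite derivnZ derivnXn subnn ffactnn expr0 hornerZ hornerMn hornerC mulrC.
by move=> s; rewrite h hornerZ hornerXn mulrC.
Qed.

(** Parametrized polynomials whose integral over the unit interval is a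
    polynomial function of the parameter. *)
Definition polyfam (G : V -> {poly R}) := exists N,
  (forall y, (size (G y) <= N)%N) /\ forall k, polyfun (fun y => (G y)`_k).

Lemma polyfam_lin b c : polyfun b -> polyfun c ->
  polyfam (fun y => b y *: 'X + (c y)%:P).
Proof.
move=> pb pc; exists 2; split=> [y|k].
  apply: (leq_trans (size_polyD _ _)); rewrite geq_max.
  rewrite (leq_trans (size_scale_leq _ _)) ?size_polyX //=.
  exact: leq_trans (size_polyC_leq1 _) _.
have -> : (fun y => (b y *: 'X + (c y)%:P)`_k) =
    (fun y => b y * (k == 1%N)%:R + (if k == 0%N then c y else 0)).
  by apply/funext => y; rewrite coefD coefZ coefX coefC.
apply: polyfunD; first by apply: polyfunM => //; apply: polyfun_cst.
by case: (k == 0%N) => //; apply: polyfun_cst.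
Qed.

Lemma polyfamM G H : polyfam G -> polyfam H -> polyfam (fun y => G y * H y).
Proof.
move=> [N1 [s1 p1]] [N2 [s2 p2]]; exists (N1 + N2)%N; split=> [y|k].
  apply: (leq_trans (size_polyMleq _ _)); rewrite -subn1 leq_subLR.
  by rewrite (leq_trans (leq_add (s1 y) (s2 y))) // leq_addl.
have -> : (fun y => (G y * H y)`_k) =
    (fun y => \sum_(i < k.+1) (G y)`_i * (H y)`_(k - i)).
  by apply/funext => y; rewrite coefM.
by apply: polyfun_sum => i; apply: polyfunM.
Qed.

Lemma polyfam1 : polyfam (fun=> 1).
Proof.
exists 1%N; split=> [y|k]; first by rewrite size_poly1.
exact: polyfun_cst.
Qed.

Lemma polyfamX G k : polyfam G -> polyfam (fun y => G y ^+ k).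
Proof.
move=> hG; elim: k => [|k IH]; first exact: polyfam1.
have -> : (fun y => G y ^+ k.+1) = (fun y => G y * G y ^+ k).
  by apply/funext => y; rewrite exprS.
exact: polyfamM.
Qed.

Lemma polyfam_prod (I : Type) (r : seq I) (P : pred I) (G : I -> V -> {poly R}) :
  (forall i, polyfam (G i)) -> polyfam (fun y => \prod_(i <- r | P i) G i y).
Proof.
move=> hG; elim: r => [|i r IH].
  have -> : (fun y => \prod_(i <- [::] | P i) G i y) = (fun=> 1).
    by apply/funext => y; rewrite big_nil.
  exact: polyfam1.
have -> : (fun y => \prod_(j <- i :: r | P j) G j y) =
    (fun y => (if P i then G i y else 1) * \prod_(j <- r | P j) G j y).
  by apply/funext => y; rewrite big_cons; case: ifP; rewrite ?mul1r.
by apply: polyfamM => //; case: (P i) => //; apply: polyfam1.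
Qed.

Lemma polyfam_int G : polyfam G -> polyfun (fun y => int01 (recip R) (G y)).
Proof.
move=> [N [sG pG]].
have -> : (fun y => int01 (recip R) (G y)) = (fun y => \sum_(k < N) (G y)`_k * recip R k).
  by apply/funext => y; apply: int01_wide.
by apply: polyfun_sum => k; apply: polyfunM => //; apply: polyfun_cst.
Qed.

Section ThetaFun.
Variables (N : nat) (xi : 'I_N -> V -> R) (e : 'I_N -> nat).
Hypothesis pxi : forall i, polyfun (xi i).

Definition theta_fun i y : R := (prim (recip R) (nodal (xi^~ y) e)).[xi i y].

Lemma theta_funE i y : theta_fun i y =
  xi i y * int01 (recip R) (\prod_l (xi i y *: 'X - (xi l y)%:P) ^+ e l).
Proof. exact: (theta_int (@recipK R)). Qed.

Lemma polyfun_theta i : polyfun (theta_fun i).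
Proof.
have -> : theta_fun i = (fun y => xi i y *
    int01 (recip R) (\prod_l (xi i y *: 'X + (-1 * xi l y)%:P) ^+ e l)).
  apply/funext => y; rewrite theta_funE; congr (_ * int01 _ _).
  by apply: eq_bigr => l _; rewrite mulN1r polyCN.
apply: polyfunM => //; apply: polyfam_int; apply: polyfam_prod => l.
apply: polyfamX; apply: polyfam_lin => //.
by apply: polyfunM => //; apply: polyfun_cst.
Qed.

Lemma polyfun_gap i k : polyfun (fun y => nodal_gap (recip R) (xi^~ y) e i k).
Proof.
apply: polyfam_int; apply: polyfamM; last first.
  apply: polyfam_prod => l; apply: polyfamX.
  have -> : (fun y => (xi i y - xi l y)%:P + (xi k y - xi i y) *: 'X) =
     (fun y => (xi k y - xi i y) *: 'X + (xi i y - xi l y)%:P).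
    by apply/funext => y; rewrite addrC.
  by apply: polyfam_lin; apply: polyfunB.
exists (size ('X^(e i) * ('X - 1) ^+ e k : {poly R})); split=> // j.
exact: polyfun_cst.
Qed.

(** The difference of the two pieces is a polynomial multiple of a power of
    [xi k - xi i]. *)
Lemma theta_fun_vanish i k x w : i != k -> xi i x = xi k x ->
  (size w < (e i + e k).+1)%N ->
  pderives w (theta_fun k - theta_fun i) x = 0.
Proof.
move=> ik xik wm.
have -> : theta_fun k - theta_fun i = (fun y => (xi k y - xi i y) ^+ (e i + e k).+1 *
    nodal_gap (recip R) (xi^~ y) e i k).
  by apply/funext => y; apply: (theta_diff (@recipK R)).
apply: polyfun_vanish => //; first exact: polyfunB.
  exact: polyfun_gap.
by rewrite xik subrr.
Qed.

End ThetaFun.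
End PolyFun.

(** * Barycentric coordinates *)

Section Simplex.
Context {R : realType} {n : nat}.
Local Notation V := 'rV[R]_n.
Implicit Types (T F S C P Q : {fset V}) (x y u v c : V) (w : V -> R).

Definition affine_fun (l : V -> R) := exists (g : 'cV[R]_n) (h : R),
  forall y, l y = (y *m g) 0 0 + h.

Lemma affine_comb l S w : affine_fun l -> \sum_(x <- S) w x = 1 ->
  l (\sum_(x <- S) w x *: x) = \sum_(x <- S) w x * l x.
Proof.
move=> [g [h hl]] w1; rewrite hl mulmx_suml summxE -[h]mul1r -w1 mulr_suml -big_split.
by apply: eq_bigr => x _ /=; rewrite hl mulrDr -scalemxAl mxE.
Qed.

Lemma affine_lin l (a b : R) l' : affine_fun l -> affine_fun l' ->
  affine_fun (fun y => a * l y + b * l' y).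
Proof.
move=> [g [h hl]] [g' [h' hl']]; exists (a *: g + b *: g'), (a * h + b * h') => y.
by rewrite hl hl' mulmxDr -!scalemxAr !mxE; ring.
Qed.

Lemma affine_cst (a : R) : affine_fun (fun=> a).
Proof. by exists 0, a => y; rewrite mulmx0 mxE add0r. Qed.

Lemma affine_move (l : V -> R) (I : Type) (t : seq I) (a : I -> R) (p : I -> V) y v :
  affine_fun l -> l (y + \sum_(i <- t) a i *: (p i - v)) =
    l y + \sum_(i <- t) a i * (l (p i) - l v).
Proof.
move=> [g [h hl]]; elim: t => [|i t IH]; first by rewrite !big_nil !addr0.
rewrite !big_cons addrCA [RHS]addrCA -IH !hl mulmxDl -scalemxAl mulmxBl !mxE.
by ring.
Qed.

Lemma sum_delta (W : lmodType R) F y (g : V -> W) : y \in F ->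
  \sum_(x <- F) (x == y)%:R *: g x = g y.
Proof.
move=> yF; rewrite (big_fsetD1 y) //= eqxx scale1r big1_fset ?addr0 // => x.
by rewrite !inE => /andP[/negPf ->]; rewrite scale0r.
Qed.

Lemma sum_delta1 F y : y \in F -> \sum_(x <- F) (x == y)%:R = 1 :> R.
Proof.
move=> yF; rewrite -[RHS](@sum_delta R^o F y (fun=> 1) yF).
by apply: eq_bigr => x _; rewrite [_ *: _]mulr1.
Qed.

Lemma aff_unique S w w' : aff_indep S -> \sum_(x <- S) w x = \sum_(x <- S) w' x ->
  \sum_(x <- S) w x *: x = \sum_(x <- S) w' x *: x -> forall x, x \in S -> w x = w' x.
Proof.
move=> aS e1 e2 x xS; apply/eqP; rewrite -subr_eq0; apply/eqP.
apply: (aS (fun x => w x - w' x)) => //; first by rewrite sumrB e1 subrr.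
by under eq_bigr do rewrite scalerBl; rewrite sumrB e2 subrr.
Qed.

Definition wext F w : V -> R := fun x => if x \in F then w x else 0.

Lemma wext_sum (W : lmodType R) F S w (g : V -> W) : (F `<=` S)%fset ->
  \sum_(x <- S) wext F w x *: g x = \sum_(x <- F) w x *: g x.
Proof.
move=> FS; rewrite -(big_fset_incl _ FS).
  by apply: eq_big_seq => x xF; rewrite /wext xF.
by move=> x _ /negPf xF; rewrite /wext xF scale0r.
Qed.

Lemma wext_sum1 F S w : (F `<=` S)%fset ->
  \sum_(x <- S) wext F w x = \sum_(x <- F) w x.
Proof.
move=> FS; have := @wext_sum R^o F S w (fun=> 1) FS.
by under eq_bigr do rewrite [_ *: _]mulr1; under [in RHS]eq_bigr do rewrite [_ *: _]mulr1.
Qed.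

Lemma aff_indepS F S : (F `<=` S)%fset -> aff_indep S -> aff_indep F.
Proof.
move=> FS aS w w0 w1 x xF.
have := aS (wext F w); rewrite wext_sum1 // (wext_sum w id FS) => /(_ w0 w1 x).
by rewrite /wext xF; apply; apply: (fsubsetP FS).
Qed.

Lemma conv_mem S x : x \in S -> conv_hull S x.
Proof.
move=> xS; exists (fun y => (y == x)%:R); split=> [y _||].
- by rewrite ler0n.
- exact: sum_delta1.
- by rewrite sum_delta.
Qed.

Lemma convS F S : (F `<=` S)%fset -> conv_hull F `<=` conv_hull S.
Proof.
move=> FS y [w [w0 w1 ->]]; exists (wext F w); split.
- by move=> x _; rewrite /wext; case: ifP => // /w0.
- by rewrite wext_sum1.
- by rewrite (wext_sum w id FS).
Qed.

(** The matrix with rows [(1, x)], for [x] a vertex, is invertible by affine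
    independence, and its inverse computes the coordinates. *)
Lemma bary_exists T : is_simplex n T -> exists b : V -> V -> R,
  [/\ forall x, affine_fun (b x), forall y, \sum_(x <- T) b x y = 1 &
      forall y, y = \sum_(x <- T) b x y *: x].
Proof.
move=> [cT aT].
pose z (i : 'I_n.+1) : V := nth 0 T i.
have szT : size T = n.+1 by rewrite -cT.
have zT i : z i \in T by rewrite mem_nth // szT.
have idx i : index (z i) T = i by rewrite index_uniq ?fset_uniq ?szT.
have sumT (W : nmodType) (g : V -> W) : \sum_(x <- T) g x = \sum_i g (z i).
  by rewrite (big_nth 0) szT big_mkord.
pose M : 'M[R]_(n.+1, 1 + n) := \matrix_i row_mx 1%:M (z i).
have vM (v : 'rV_n.+1) : v *m M = row_mx (\sum_i v 0 i)%:M (\sum_i v 0 i *: z i).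
  rewrite mulmx_sum_row; under eq_bigr do rewrite rowK scale_row_mx.
  apply/rowP => j; rewrite summxE; case: (split_ordP j) => k ->.
    rewrite row_mxEl !ord1 mxE eqxx mulr1n; apply: eq_bigr => i _.
    by rewrite row_mxEl !mxE mulr1.
  by rewrite row_mxEr summxE; apply: eq_bigr => i _; rewrite row_mxEr.
have Munit : M \in unitmx.
  rewrite -row_free_unit; apply: inj_row_free => v; rewrite vM => v0.
  have : row_mx (\sum_i v 0 i)%:M (\sum_i v 0 i *: z i) = row_mx 0 0 :> 'rV_(1 + n).
    by rewrite v0 row_mx0.
  move=> /eq_row_mx[/matrixP/(_ 0 0)]; rewrite !mxE eqxx mulr1n => s0 s1.
  apply/rowP => i; rewrite [RHS]mxE.
  have := aT (fun x => v 0 (inord (index x T))); rewrite !sumT.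
  under eq_bigr do rewrite idx inord_val.
  under [X in _ -> X = 0 -> _]eq_bigr do rewrite idx inord_val.
  by move=> /(_ s0 s1 (z i) (zT i)); rewrite idx inord_val.
pose B y : 'rV[R]_n.+1 := row_mx 1%:M y *m invmx M.
exists (fun x y => B y 0 (inord (index x T))); split.
- move=> x; set k := inord _.
  exists (\col_i (invmx M) (rshift 1 i) k), ((invmx M) (lshift n (ord0 : 'I_1)) k) => y.
  rewrite /B mxE big_split_ord /= big_ord1 row_mxEl mxE eqxx mul1r addrC; congr (_ + _).
  by rewrite mxE; apply: eq_bigr => i _; rewrite row_mxEr mxE.
- move=> y; have := vM (B y); rewrite /B mulmxKV // -/(B y) => /eq_row_mx[/matrixP/(_ 0 0)].
  rewrite !mxE eqxx !mulr1n sumT => -> _.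
  by apply: eq_bigr => i _; rewrite idx inord_val.
- move=> y; have := vM (B y); rewrite /B mulmxKV // -/(B y) => /eq_row_mx[_ {1}->].
  by rewrite sumT; apply: eq_bigr => i _; rewrite idx inord_val.
Qed.

Lemma bary_vertex T (b : V -> V -> R) : aff_indep T ->
  (forall y, \sum_(x <- T) b x y = 1) -> (forall y, y = \sum_(x <- T) b x y *: x) ->
  forall x y, x \in T -> y \in T -> b x y = (x == y)%:R.
Proof.
move=> aT b1 bE x y xT yT.
apply: (@aff_unique T (fun x => b x y) (fun x => (x == y)%:R)) => //.
  by rewrite b1 sum_delta1.
by rewrite -bE sum_delta.
Qed.

(** Every step of the split trades a vertex for a point with nonzero coordinate
    there. *)
Lemma simplex_exchange j P x c w : is_simplex j P -> x \in P ->
  \sum_(p <- P) w p = 1 -> c = \sum_(p <- P) w p *: p -> w x != 0 ->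
  c \notin (P `\ x)%fset /\ is_simplex j (c |` (P `\ x))%fset.
Proof.
move=> [cP aP] xP w1 cE wx.
have cN : c \notin (P `\ x)%fset.
  apply/negP => cPx; case/eqP: wx.
  have cinP : c \in P by move: cPx; rewrite !inE => /andP[].
  rewrite (@aff_unique P w (fun p => (p == c)%:R)) //.
  - by move: cPx; rewrite !inE eq_sym => /andP[/negPf ->].
  - by rewrite w1 sum_delta1.
  - by rewrite -cE sum_delta.
split=> //; split.
  by rewrite cardfsU1 cN; move: cP; rewrite (cardfsD1 x) xP.
move=> t; rewrite !big_fsetU1 //= => t0 t1.
pose s p := t c * w p + (if p == x then 0 else t p).
have sP : forall p, p \in P -> s p = 0.
  apply: aP.
    rewrite big_split /= -mulr_sumr w1 mulr1 (big_fsetD1 x) //= eqxx add0r -[RHS]t0.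
    congr (_ + _); apply: eq_big_seq => p; rewrite !inE => /andP[/negPf -> _] //.
  rewrite /s; under eq_bigr do rewrite scalerDl -scalerA.
  rewrite big_split /= -scaler_sumr -cE [X in _ + X](big_fsetD1 x) //= eqxx scale0r add0r.
  rewrite -[RHS]t1; congr (_ + _).
  by apply: eq_big_seq => p; rewrite !inE => /andP[/negPf -> _].
have tc : t c = 0.
  have := sP x xP; rewrite /s eqxx addr0 => /eqP; rewrite mulf_eq0 (negPf wx) orbF.
  by move/eqP.
move=> p; rewrite !inE => /predU1P[-> //|/andP[px pP]].
by have := sP p pP; rewrite /s tc mul0r add0r (negPf px).
Qed.

(** If the weight of a vertex [x] were zero, the points slightly beyond [c] on the
    line from [x] would lie in the affine hull but outside the simplex. *)
Lemma rel_interior_pos F c : aff_indep F -> rel_interior F c ->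
  exists w, [/\ forall x, x \in F -> 0 < w x, \sum_(x <- F) w x = 1 &
                c = \sum_(x <- F) w x *: x].
Proof.
move=> aF [[w [w0 w1 cE]] hc]; exists w; split=> // x xF.
rewrite lt_def w0 // andbT; apply/negP => /eqP wx.
have /nbhs_ballP[d d0 hd] := hc.
pose t := d / 2 / (`|c - x| + 1).
have p0 : 0 < `|c - x| + 1 by rewrite ltr_wpDl.
have t0 : 0 < t by rewrite !divr_gt0.
pose y := c + t *: (c - x).
pose wy z := (1 + t) * w z - t * (z == x)%:R.
have yE : y = \sum_(z <- F) wy z *: z.
  under eq_bigr do rewrite scalerBl -[(_ * w _) *: _]scalerA -[(t * _) *: _]scalerA.
  rewrite sumrB -!scaler_sumr -cE sum_delta //.
  by rewrite /y scalerBr scalerDl scale1r addrA.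
have wy1 : \sum_(z <- F) wy z = 1.
  by rewrite sumrB -!mulr_sumr w1 sum_delta1 // !mulr1 addrK.
have yb : ball c d y.
  rewrite -ball_normE /= /y opprD addrA subrr add0r normrN normrZ gtr0_norm //.
  have : t * (`|c - x| + 1) = d / 2 by rewrite /t mulfVK // gt_eqF.
  rewrite mulrDr mulr1 => e; have : d / 2 < d by rewrite ltr_pdivrMr // ltr_pMr // ltr1n.
  by rewrite -e; apply: le_lt_trans; rewrite lerDl ltW.
have [w' [w'0 w'1 yE']] := hd _ yb (ex_intro _ wy (conj wy1 yE)).
have := w'0 x xF; rewrite -(@aff_unique F wy w' aF _ _ x xF) ?wy1 -?yE //.
by rewrite /wy wx mulr0 eqxx sub0r mulr1 oppr_ge0 leNgt t0.
Qed.

End Simplex.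

(** * Cells of the split *)

Section Cells.
Context {R : realType} {n : nat}.
Local Notation V := 'rV[R]_n.
Implicit Types (T F S C P Q A B : {fset V}) (x y u v : V) (w : V -> R).
Variables (k : nat) (c : {fset V} -> V).

(** A face with [k] vertices counts as its own only cell, so that the initial step
    of the split has the same form as the later ones. *)
Inductive pcell : {fset V} -> {fset V} -> Prop :=
| pcell_base F : #|` F| = k -> pcell F F
| pcell_step F x S : (k < #|` F|)%N -> x \in F -> pcell (F `\ x)%fset S ->
    pcell F (c F |` S)%fset.

Lemma card_fsetD1 F x : x \in F -> #|` F| = #|` (F `\ x)%fset|.+1.
Proof. by move=> xF; rewrite (cardfsD1 x) xF. Qed.

Lemma pcell_card F S : pcell F S -> (k <= #|` F|)%N.
Proof. by case=> {F S} [F ->|F x S /ltnW]. Qed.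

Lemma pcell_stepP F S : (k < #|` F|)%N -> pcell F S ->
  exists x A, [/\ x \in F, pcell (F `\ x)%fset A & S = (c F |` A)%fset].
Proof.
move=> kF H; case: H kF => {F S} [F -> |F x S _ xF cS _]; first by rewrite ltnn.
by exists x, S.
Qed.

Lemma pcell_baseP F S : #|` F| = k -> pcell F S -> S = F.
Proof.
move=> kF H; case: H kF => {F S} [//|F x S kF _ _ e].
by move: kF; rewrite e ltnn.
Qed.

Lemma split_pcell F S : (k < #|` F|)%N -> split_cells k c F S <-> pcell F S.
Proof.
move=> kF; split=> [H|].
  elim: H kF => {F S} [F x cF xF kF|F x S cF xF _ IH kF].
    apply: (pcell_step kF xF); apply: pcell_base.
    by move: cF; rewrite (card_fsetD1 xF) => -[].
  apply: (pcell_step kF xF); apply: IH.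
  by move: cF; rewrite (card_fsetD1 xF).
move=> H; elim: H kF => {F S} [F ->|F x S kF xF cS IH _]; first by rewrite ltnn.
have [e|ne] := eqVneq #|` (F `\ x)%fset| k.
  rewrite (pcell_baseP e cS); apply: split_first => //.
  by rewrite (card_fsetD1 xF) e.
have lt : (k < #|` (F `\ x)%fset|)%N by rewrite ltn_neqAle eq_sym ne (pcell_card cS).
by apply: (@split_next _ _ k c F x) => //; [rewrite (card_fsetD1 xF)|exact: IH].
Qed.

Lemma pcell_exists F : (0 < k)%N -> (k <= #|` F|)%N -> exists S, pcell F S.
Proof.
move=> k0; have [m] := ubnP #|` F|; elim: m F => // m IH F Fm.
rewrite leq_eqVlt => /orP[/eqP e|kF]; first by exists F; apply: pcell_base.
have /fset0Pn[x xF] : F != fset0 by rewrite -cardfs_gt0 (leq_trans _ kF).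
have [||S HS] := IH (F `\ x)%fset.
- by move: Fm; rewrite (card_fsetD1 xF).
- by move: kF; rewrite (card_fsetD1 xF).
by exists (c F |` S)%fset; apply: pcell_step HS.
Qed.

Variable T : {fset V}.
Hypothesis T_simplex : is_simplex n T.
Hypothesis c_int : forall F, (F `<=` T)%fset -> (k < #|` F|)%N -> rel_interior F (c F).

Lemma c_weights F : (F `<=` T)%fset -> (k < #|` F|)%N ->
  exists w, [/\ forall x, x \in F -> 0 < w x, \sum_(x <- F) w x = 1 &
                c F = \sum_(x <- F) w x *: x].
Proof.
move=> FT kF; apply: rel_interior_pos; last exact: c_int.
by apply: (aff_indepS FT); case: T_simplex.
Qed.

Lemma pcell_conv F S : (F `<=` T)%fset -> pcell F S -> forall x, x \in S -> conv_hull F x.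
Proof.
move=> FT H; elim: H FT => {F S} [F _ _ x|F x S kF xF _ IH FT y]; first exact: conv_mem.
rewrite !inE => /predU1P[->|yS]; first by case: (c_int FT kF).
apply: (convS (fsubD1set F x)); apply: IH => //.
exact: fsubset_trans (fsubD1set _ _) FT.
Qed.

(** In a chain of faces from [F] up to [T], [C] stands for the points chosen in the
    faces strictly above [F]: it completes the cells over [F] to cells of the
    split. *)
Definition flag F C := [/\ (F `<=` T)%fset, is_simplex n (F `|` C)%fset &
  (#|` F| + #|` C| <= n.+1)%N].

Lemma flag_disjoint F C x : flag F C -> x \in F -> x \notin C.
Proof.
move=> [_ [cs _] le] xF; apply/negP => xC.
have := cardfsUI F C; rewrite cs => e.
suff : (0 < #|` (F `&` C)%fset|)%N by move: e le; lia.
by rewrite cardfs_gt0; apply/fset0Pn; exists x; rewrite !inE xF.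
Qed.

Lemma flag_step F C x : flag F C -> (k < #|` F|)%N -> x \in F ->
  flag (F `\ x)%fset (c F |` C)%fset.
Proof.
move=> fl kF xF; have [FT sFC le] := fl.
have [w [w0 w1 cE]] := c_weights FT kF.
have E : ((F `\ x) `|` (c F |` C) = c F |` ((F `|` C) `\ x))%fset.
  have xC := flag_disjoint fl xF.
  apply/fsetP => y; rewrite !inE; case: (y =P x) => [->|] //=.
    by rewrite (negPf xC) !orbF.
  by move=> _; rewrite orbCA.
split.
- exact: fsubset_trans (fsubD1set _ _) FT.
- rewrite E; have := @simplex_exchange _ _ n (F `|` C)%fset x (c F) (wext F w) sFC.
  rewrite !inE xF wext_sum1 ?fsubsetUl // (wext_sum w id) ?fsubsetUl // => /(_ isT w1 cE).
  by rewrite /wext xF gt_eqF ?w0 // => /(_ isT)[].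
- rewrite cardfsU1; move: le; rewrite (card_fsetD1 xF).
  by case: (c F \notin C) => /=; lia.
Qed.

Lemma flag_cell F C A : flag F C -> pcell F A -> is_simplex n (A `|` C)%fset.
Proof.
move=> fl H; elim: H C fl => {F A} [F _ C [] //|F x S kF xF _ IH C fl].
have := IH _ (flag_step fl kF xF).
by rewrite fsetUCA fsetUA.
Qed.

(** On the intersection the separating function [l] is both nonnegative and
    nonpositive, so the vertex off the facet has weight zero. *)
Lemma conv_facet (l : V -> R) Q e e' : affine_fun l ->
  (forall q, q \in Q -> l q = 0) -> 0 < l e -> l e' < 0 ->
  conv_hull (e |` Q)%fset `&` conv_hull (e' |` Q)%fset = conv_hull Q.
Proof.
move=> al lQ le le'; rewrite eqEsubset; split; last first.
  by move=> y hy; split; apply: (convS _ hy); apply: fsubsetU1.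
have eQ : e \notin Q by apply/negP => /lQ h; rewrite h ltxx in le.
have eQ' : e' \notin Q by apply/negP => /lQ h; rewrite h ltxx in le'.
have lv w e0 : e0 \notin Q -> \sum_(x <- (e0 |` Q)%fset) w x = 1 ->
    l (\sum_(x <- (e0 |` Q)%fset) w x *: x) = w e0 * l e0.
  move=> e0Q w1; rewrite (affine_comb al w1) big_fsetU1 //= big1_fset ?addr0 // => q qQ _.
  by rewrite lQ ?mulr0.
move=> y [[w [w0 w1 yE]] [w' [w'0 w'1 yE']]].
have ly : l y = w e * l e by rewrite yE lv.
have ly' : l y = w' e' * l e' by rewrite yE' lv.
have we : w e = 0.
  have h1 : 0 <= w e by apply: w0; rewrite !inE eqxx.
  have h2 : 0 <= w' e' by apply: w'0; rewrite !inE eqxx.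
  apply/eqP; rewrite eq_le h1 andbT -(pmulr_lle0 _ le) -ly ly'.
  by rewrite nmulr_lle0.
exists w; split.
- by move=> q qQ; apply: w0; rewrite !inE qQ orbT.
- by rewrite -w1 big_fsetU1 //= we add0r.
- by rewrite yE big_fsetU1 //= we scale0r add0r.
Qed.

(** Removing [x] and [x'] in either order leads to the same smaller face, and any
    cell [B] of it extends on both sides: by the point chosen in the intermediate
    face or, when this face has only [k] vertices, by its remaining vertex. *)
Lemma adjacent_cells F x x' : (0 < k)%N -> (F `<=` T)%fset -> (k < #|` F|)%N ->
    x \in F -> x' \in F -> x != x' ->
  exists e e' B, [/\ pcell (F `\ x)%fset (e |` B)%fset, pcell (F `\ x')%fset (e' |` B)%fset,
    forall b, b \in B -> conv_hull (F `\ x `\ x')%fset b,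
    exists w, [/\ \sum_(z <- (F `\ x)%fset) w z = 1,
      e = \sum_(z <- (F `\ x)%fset) w z *: z & 0 < w x'] &
    exists w, [/\ \sum_(z <- (F `\ x')%fset) w z = 1,
      e' = \sum_(z <- (F `\ x')%fset) w z *: z & 0 < w x]].
Proof.
move=> k0 FT kF xF x'F xx'.
have xF' : x \in (F `\ x')%fset by rewrite !inE xx' xF.
have x'F' : x' \in (F `\ x)%fset by rewrite !inE eq_sym xx' x'F.
have comm : ((F `\ x') `\ x = (F `\ x) `\ x')%fset by apply/fsetP => y; rewrite !inE andbCA.
have cF := card_fsetD1 xF; have cF' := card_fsetD1 x'F.
have sub1 : (F `\ x `<=` T)%fset by apply: fsubset_trans FT; apply: fsubD1set.
have sub1' : (F `\ x' `<=` T)%fset by apply: fsubset_trans FT; apply: fsubD1set.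
have [k1|k1] := leqP #|` (F `\ x)%fset| k.
  have e1 : #|` (F `\ x)%fset| = k by apply/eqP; rewrite eqn_leq k1 -ltnS -cF.
  have e1' : #|` (F `\ x')%fset| = k by apply: succn_inj; rewrite -cF' cF e1.
  have vert (G : {fset V}) z : z \in G -> exists w,
      [/\ \sum_(y <- G) w y = 1, z = \sum_(y <- G) w y *: y & 0 < w z].
    move=> zG; exists (fun y => (y == z)%:R); rewrite eqxx ltr01; split=> //.
      exact: sum_delta1.
    by rewrite sum_delta.
  exists x', x, (F `\ x `\ x')%fset; split.
  - by rewrite fsetD1K //; apply: pcell_base.
  - by rewrite -comm fsetD1K //; apply: pcell_base.
  - by move=> b; apply: conv_mem.
  - exact: vert.
  - exact: vert.
have k1' : (k < #|` (F `\ x')%fset|)%N by apply: leq_trans k1 _; rewrite -ltnS -cF -cF'.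
have [|B cB] := pcell_exists (F := (F `\ x `\ x')%fset) k0.
  by rewrite -ltnS -(card_fsetD1 x'F').
have [w [w0 w1 wE]] := c_weights sub1 k1.
have [w' [w0' w1' wE']] := c_weights sub1' k1'.
exists (c (F `\ x)%fset), (c (F `\ x')%fset), B; split.
- exact: pcell_step cB.
- by apply: (pcell_step k1' xF'); rewrite comm.
- by apply: (pcell_conv _ cB); apply: fsubset_trans sub1; apply: fsubD1set.
- by exists w; split=> //; apply: w0.
- by exists w'; split=> //; apply: w0'.
Qed.

Section Star.
Variables (r : nat) (Delta : set {fset V}) (v : V) (sigma : spline_family (R := R) (n := n)).
Hypothesis n_gt0 : (0 < n)%N.
Hypothesis sigmaS : spline_smooth r Delta sigma.

Definition cell_jet S := jet (sigma S).2 v.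

Lemma cell_jet_sym S : Delta S -> v \in S -> jsym (cell_jet S).
Proof.
move=> DS vS; have [oU cU sU] := sigmaS.1 S DS.
by apply: (jet_sym oU sU); apply/cU/conv_mem.
Qed.

(** The difference of the two pieces vanishes on the common facet together with its
    derivatives up to order [r], so its Taylor forms at [v] vanish along the
    hyperplane spanned by the facet, which is the zero set of [l]. *)
Lemma facet_jets Q e e' (l : V -> R) u : Delta (e |` Q)%fset -> Delta (e' |` Q)%fset ->
  is_simplex n (e |` Q)%fset -> is_simplex n (e' |` Q)%fset ->
  affine_fun l -> (forall q, q \in Q -> l q = 0) -> 0 < l e -> l e' < 0 ->
  v \in Q -> l (v + u) = 0 -> forall j (w : seq 'I_n), (size w <= r)%N ->
  iter j (jshift u) (cell_jet (e |` Q)%fset) w = iter j (jshift u) (cell_jet (e' |` Q)%fset) w.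
Proof.
set S := (e |` Q)%fset; set S' := (e' |` Q)%fset.
move=> DS DS' sS sS' al lQ le le' vQ lvu j w wr.
have [oU cU sU] := sigmaS.1 S DS; have [oU' cU' sU'] := sigmaS.1 S' DS'.
pose U := (sigma S).1 `&` (sigma S').1.
have oUU : open U by apply: openI.
have sf : smooth_on U (sigma S).2 by apply: smooth_sub sU => ? [].
have sf' : smooth_on U (sigma S').2 by apply: smooth_sub sU' => ? [].
have QS : (Q `<=` S)%fset by apply: fsubsetU1.
have QS' : (Q `<=` S')%fset by apply: fsubsetU1.
have eQ : e \notin Q by apply/negP => /lQ h; rewrite h ltxx in le.
have cQ : #|` Q| = n.-1.+1.
  by rewrite prednK //; have := sS.1; rewrite /S cardfsU1 eQ => -[].
have KI := conv_facet al lQ le le'.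
have QU : conv_hull Q `<=` U.
  by move=> y hy; split; [apply/cU/(convS QS)|apply/cU'/(convS QS')].
have Uv : U v by apply/QU/conv_mem.
have zero x (w' : seq 'I_n) : conv_hull Q x -> (size w' <= r)%N ->
    pderives w' ((sigma S).2 - (sigma S').2) x = 0.
  move=> Qx wr'; rewrite (pderivesB oUU) //; last exact: QU.
  apply/eqP; rewrite subr_eq0; apply/eqP.
  rewrite -[LHS](mi_derive_jet w' oUU sf (QU _ Qx)) -[RHS](mi_derive_jet w' oUU sf' (QU _ Qx)).
  apply: sigmaS.2 => //.
  - by exists Q; split.
  - by exists Q; split.
  - by rewrite mi_of_order.
  - by rewrite KI.
have [b [ab b1 bE]] := bary_exists sS.
(* As [l] vanishes at [v + u], this point is an affine combination of the facet. *)
pose om z := b z (v + u).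
have om_e : om e = 0.
  have : l (v + u) = om e * l e.
    rewrite {1}[v + u]bE (affine_comb al) // /S big_fsetU1 //= big1_fset ?addr0 // => q qQ _.
    by rewrite lQ ?mulr0.
  by rewrite lvu => /esym/eqP; rewrite mulf_eq0 (gt_eqF le) orbF => /eqP.
have om1 : \sum_(q <- Q) om q = 1.
  by rewrite -(b1 (v + u)) /S big_fsetU1 //= -/(om e) om_e add0r.
have omE : v + u = \sum_(q <- Q) om q *: q.
  by rewrite {1}[v + u]bE /S big_fsetU1 //= -/(om e) om_e scale0r add0r.
(* [u1] points to the barycentre of the facet, which has [n] vertices; as long as
   [s <= eps] the perturbed weights stay nonnegative. *)
pose nu : R := n%:R^-1.
have n0 : (0 : R) < n%:R by rewrite ltr0n.
have nu0 : 0 < nu by rewrite invr_gt0.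
pose u1 := \sum_(q <- Q) nu *: q - v.
pose M := 1 + \sum_(q <- Q) `|om q|.
have M0 : 0 < M by rewrite ltr_wpDr // sumr_ge0.
have omM q : q \in Q -> `|om q| <= M.
  move=> qQ; rewrite /M (big_fsetD1 q) //= addrCA lerDl.
  by rewrite addr_ge0 // sumr_ge0.
pose eps := (1 + n%:R * M)^-1.
have den0 : 0 < 1 + n%:R * M by rewrite addr_gt0 // mulr_gt0.
have nu1 : \sum_(q <- Q) nu = 1.
  by rewrite big_const_seq count_predT cQ prednK // iter_addr_0 -mulr_natr mulVf // gt_eqF.
suff : iter j (jshift u) (jet ((sigma S).2 - (sigma S').2) v) w = 0.
  have -> : iter j (jshift u) (jet ((sigma S).2 - (sigma S').2) v) w =
     iter j (jshift u) (fun w : seq 'I_n => cell_jet S w - cell_jet S' w) w.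
    by apply: eq_iter_jshift => w' _; rewrite /jet (pderivesB oUU).
  by rewrite iter_jshiftB => /eqP; rewrite subr_eq0 => /eqP.
apply: (@facet_vanish R n U (conv_hull Q) _ v r u u1 eps) => //.
- exact: smoothB.
- by rewrite invr_gt0.
move=> s t /andP[s0 se] /andP[t0 t1].
pose ww q := t * ((1 - s) * nu + s * om q) + (1 - t) * (q == v)%:R.
exists ww; split.
- move=> q qQ; rewrite addr_ge0 ?mulr_ge0 ?subr_ge0 //.
  have h1 : s * (1 + n%:R * M) <= 1 by rewrite -ler_pdivlMr // div1r.
  have h2 : s * `|om q| <= s * M by rewrite ler_wpM2l // omM.
  have h3 : - (s * `|om q|) <= s * om q.
    by rewrite -mulrN ler_wpM2l // lerNl; rewrite -normrN ler_norm.
  have h4 : s * M <= (1 - s) * nu by rewrite ler_pdivlMr //; lra.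
  rewrite -lerBlDr sub0r; apply: le_trans h4; rewrite lerNl.
  by apply: le_trans h3; rewrite lerN2.
- rewrite big_split /= -!mulr_sumr big_split /= -!mulr_sumr om1 nu1.
  by rewrite sum_delta1 //; ring.
- have -> : \sum_(q <- Q) ww q *: q = t *: ((1 - s) *: (u1 + v) + s *: (v + u)) + (1 - t) *: v.
    rewrite /ww; under eq_bigr do
      rewrite scalerDl -scalerA scalerDl -2!scalerA -[(_ * (_ == v)%:R) *: _]scalerA.
    rewrite big_split /= -!scaler_sumr big_split /= -!scaler_sumr -omE /u1 subrK -scaler_sumr.
    by rewrite sum_delta.
  by clearbody u1; apply/rowP => i; rewrite !mxE; ring.
Qed.

End Star.
End Cells.

(** * Agreement of the jets at the centre *)

Section Lower.
Context {R : realType} {n : nat}.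
Local Notation V := 'rV[R]_n.
Implicit Types (T F S C P Q A B : {fset V}) (x y u v : V).
Variables (k : nat) (c : {fset V} -> V) (T : {fset V}).
Hypothesis T_simplex : is_simplex n T.
Hypothesis c_int : forall F, (F `<=` T)%fset -> (k < #|` F|)%N -> rel_interior F (c F).
Variables (r : nat) (Delta : set {fset V}) (v : V) (sigma : spline_family (R := R) (n := n)).
Hypothesis n_gt0 : (0 < n)%N.
Hypothesis k_gt0 : (0 < k)%N.
Hypothesis sigmaS : spline_smooth r Delta sigma.

Let J := cell_jet v sigma.

(** Here [w] is meant to be the weights of the point chosen in [F]: divided by
    them, the coordinates of the simplex spanned by [F] and [C] at [x] and [x']
    agree exactly on the wall between the cells that miss [x] and those that miss
    [x']. *)
Lemma wall_function F C x x' (w : V -> R) : flag T F C -> x \in F -> x' \in F ->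
  exists2 l : V -> R, affine_fun l &
    (forall z, z \in F -> l z = (z == x')%:R / w x' - (z == x)%:R / w x) /\
    (forall q, q \in C -> l q = 0).
Proof.
move=> fl xF x'F; have [FT sFC _] := fl.
have [b [ab b1 bE]] := bary_exists sFC.
have bv := bary_vertex sFC.2 b1 bE.
have inFC z : z \in F -> z \in (F `|` C)%fset by move=> zF; rewrite inE zF.
exists (fun y => (w x')^-1 * b x' y + - (w x)^-1 * b x y); first exact: affine_lin.
split=> [z zF|q qC].
  rewrite !bv ?inFC //; rewrite (eq_sym x') (eq_sym x) mulNr.
  by rewrite [_^-1 * _]mulrC [(w x)^-1 * _]mulrC.
have qFC : q \in (F `|` C)%fset by rewrite inE qC orbT.
rewrite (bv _ _ (inFC _ x'F) qFC) (bv _ _ (inFC _ xF) qFC).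
have ne z : z \in F -> (z == q) = false.
  by move=> zF; apply: contraTF qC => /eqP <-; apply: (flag_disjoint fl).
by rewrite (ne x') // (ne x) // !mulr0 addr0.
Qed.

(** In the coordinates on [F] divided by the weights of [c F] the cells over the
    facets of [F] form the star of [star_core]; the coordinates on [C] are the same
    on all sides and go into the fixed part [y0] of the direction. *)
Lemma star_step F C D : flag T F C -> (k < #|` F|)%N -> v \in (c F |` C)%fset ->
  (forall A, pcell k c F A -> Delta (A `|` C)%fset) ->
  (D <= r + (k - 1) * (r.+1)./2)%N ->
  (forall x A A', x \in F -> pcell k c (F `\ x)%fset A -> pcell k c (F `\ x)%fset A' ->
     forall w, size w = D -> J (A `|` (c F |` C))%fset w = J (A' `|` (c F |` C))%fset w) ->
  forall A A', pcell k c F A -> pcell k c F A' ->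
    forall w, size w = D -> J (A `|` C)%fset w = J (A' `|` C)%fset w.
Proof.
move=> fl kF vcC DF Dle IH.
have [FT sFC _] := fl.
have [la [la0 la1 cE]] := c_weights T_simplex c_int FT kF.
pose N := #|` F|.-1.
have FN : #|` F| = N.+1 by rewrite prednK // (leq_ltn_trans _ kF).
have kN : (k <= N)%N by rewrite -ltnS -FN.
pose z (i : 'I_N.+1) : V := nth 0 F i.
have szF : size F = N.+1 by rewrite -FN.
have zF i : z i \in F by rewrite mem_nth // szF.
have zeq i j : (z i == z j) = (i == j) by rewrite /z nth_uniq ?fset_uniq ?szF.
have zI i j : i != j -> z i != z j by rewrite zeq.
have sumF (W : nmodType) (g : V -> W) : \sum_(x <- F) g x = \sum_i g (z i).
  by rewrite (big_nth 0) szF big_mkord.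
have zsurj x : x \in F -> exists i, z i = x.
  move=> xF; have lt : (index x F < N.+1)%N by rewrite -szF index_mem.
  by exists (Ordinal lt); rewrite /z /= nth_index.
have cellD x A : x \in F -> pcell k c (F `\ x)%fset A -> Delta (A `|` (c F |` C))%fset.
  move=> xF cA; have := DF _ (pcell_step kF xF cA).
  by rewrite fsetUCA fsetUA.
have cells x : x \in F -> exists A, pcell k c (F `\ x)%fset A.
  by move=> xF; apply: pcell_exists => //; rewrite -ltnS -(card_fsetD1 xF).
have [A0 hA0] := boolp.choice (fun i => cells (z i) (zF i)).
pose K i := J (A0 i `|` (c F |` C))%fset.
have vS A : v \in (A `|` (c F |` C))%fset by rewrite inE vcC orbT.
have K_sym i : jsym (K i) by apply: (cell_jet_sym sigmaS) => //; apply: cellD (hA0 i).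
suff main i i' w : size w = D -> K i w = K i' w.
  have rep A : pcell k c F A -> exists i, forall w, size w = D -> J (A `|` C)%fset w = K i w.
    move=> cA; have [x [B [xF cB ->]]] := pcell_stepP kF cA.
    have [i ix] := zsurj _ xF; exists i => w wD.
    have -> : (c F |` B `|` C = B `|` (c F |` C))%fset by rewrite fsetUCA fsetUA.
    by apply: (IH x) => //; rewrite -ix.
  move=> A A' /rep[i hi] /rep[i' hi'] w wD.
  by rewrite hi // hi' //; apply: main.
move=> wD; apply/eqP; rewrite -subr_eq0; apply/eqP.
apply: (@polarize R n (fun w => K i w - K i' w) D) => //.
  by move=> w1 w2 ww; rewrite (K_sym i _ _ ww) (K_sym i' _ _ ww).
move=> u; rewrite iter_jshiftB; apply/eqP; rewrite subr_eq0; apply/eqP.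
have [b [ab b1 bE]] := bary_exists sFC.
have sumFC (W : nmodType) (g : V -> W) :
    \sum_(x <- (F `|` C)%fset) g x = \sum_(x <- F) g x + \sum_(x <- C) g x.
  rewrite (big_fsetID _ (mem F)); congr (_ + _); apply: eq_fbigl => x.
    by rewrite !inE; case: (x \in F); rewrite ?andbF.
  rewrite !inE; case xF: (x \in F); rewrite /= ?andbF ?andbT //.
  by rewrite (negPf (flag_disjoint fl xF)).
pose y0 := \sum_(q <- C) b q (v + u) *: (q - v).
pose E i := la (z i) *: (z i - v).
pose a i := b (z i) (v + u) / la (z i).
have uE : u = y0 + \sum_l a l *: E l.
  have -> : \sum_l a l *: E l = \sum_(x <- F) b x (v + u) *: (x - v).
    rewrite sumF; apply: eq_bigr => l _; rewrite /a /E scalerA mulfVK //.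
    by rewrite gt_eqF // la0.
  rewrite /y0 addrC -sumFC; under eq_bigr do rewrite scalerBr.
  by rewrite sumrB -bE -scaler_suml b1 scale1r addrC addKr.
rewrite {}uE.
apply: (@star_core R N r D n _ _ y0 E K K_sym).
- exact: leq_trans kN.
- by apply: leq_trans Dle _; rewrite leq_add2l leq_mul2r leq_sub2r ?orbT.
move=> j j' jj' {a}a ajj' e w' wr ewD.
have [e1 [e2 [B [cB cB' Bconv [mu [mu1 e1E mupos]] [mu' [mu1' e2E mupos']]]]]] :=
  adjacent_cells T_simplex c_int k_gt0 FT kF (zF j) (zF j') (zI _ _ jj').
have [l al [lF lC]] := wall_function la fl (zF j) (zF j').
pose Q := (B `|` (c F |` C))%fset.
have S1 : ((e1 |` B) `|` (c F |` C) = e1 |` Q)%fset by rewrite /Q -fsetUA.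
have S2 : ((e2 |` B) `|` (c F |` C) = e2 |` Q)%fset by rewrite /Q -fsetUA.
have K1 w1 : size w1 = D -> K j w1 = J (e1 |` Q)%fset w1.
  by move=> h; rewrite -S1; apply: (IH (z j)).
have K2 w1 : size w1 = D -> K j' w1 = J (e2 |` Q)%fset w1.
  by move=> h; rewrite -S2; apply: (IH (z j')).
rewrite (@eq_iter_jshift _ _ _ (K j) (J (e1 |` Q)%fset)); last by rewrite ewD.
rewrite (@eq_iter_jshift _ _ _ (K j') (J (e2 |` Q)%fset)); last by rewrite ewD.
have lcF : l (c F) = 0.
  rewrite cE (affine_comb al la1) (big_fsetD1 (z j)) //= (big_fsetD1 (z j')) /=; last first.
    by rewrite !inE eq_sym zI // zF.
  rewrite big1_fset ?addr0 => [|y]; last first.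
    rewrite !inE => /and3P[y1 y2 yF] _.
    by rewrite lF // (negPf y1) (negPf y2) !mul0r subrr mulr0.
  rewrite !lF // !eqxx (negPf (zI _ _ jj')) eq_sym (negPf (zI _ _ jj')) !mul0r.
  by rewrite sub0r subr0 mulrN !mul1r !divff ?addNr // gt_eqF // la0.
have lQ q : q \in Q -> l q = 0.
  rewrite !inE => /or3P[qB|/eqP ->//|]; last exact: lC.
  have [w1 [_ w11 ->]] := Bconv q qB; rewrite (affine_comb al w11).
  rewrite big1_fset // => y; rewrite !inE => /and3P[y1 y2 yF] _.
  by rewrite lF // (negPf y1) (negPf y2) !mul0r subrr mulr0.
have vQ : v \in Q by rewrite inE vcC orbT.
apply: (@facet_jets R n r Delta v sigma n_gt0 sigmaS Q e1 e2 l) => //.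
- by rewrite -S1; apply: cellD cB.
- by rewrite -S2; apply: cellD cB'.
- by rewrite -S1; apply: (flag_cell T_simplex c_int) cB; apply: (flag_step T_simplex c_int).
- by rewrite -S2; apply: (flag_cell T_simplex c_int) cB'; apply: (flag_step T_simplex c_int).
- rewrite e1E (affine_comb al mu1) (big_fsetD1 (z j')) /=; last first.
    by rewrite !inE eq_sym zI // zF.
  rewrite big1_fset ?addr0 => [|y]; last first.
    rewrite !inE => /and3P[y1 y2 yF] _.
    by rewrite lF // (negPf y1) (negPf y2) !mul0r subrr mulr0.
  rewrite lF // eqxx eq_sym (negPf (zI _ _ jj')) mul0r subr0 mul1r.
  by rewrite divr_gt0 // la0.
- rewrite e2E (affine_comb al mu1') (big_fsetD1 (z j)) /=; last first.
    by rewrite !inE zI // zF.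
  rewrite big1_fset ?addr0 => [|y]; last first.
    rewrite !inE => /and3P[y1 y2 yF] _.
    by rewrite lF // (negPf y1) (negPf y2) !mul0r subrr mulr0.
  rewrite lF // eqxx (negPf (zI _ _ jj')) mul0r sub0r mul1r mulrN oppr_lt0.
  by rewrite divr_gt0 // la0.
- rewrite addrA.
  have -> : \sum_l a l *: E l = \sum_l (a l * la (z l)) *: (z l - v).
    by apply: eq_bigr => i1 _; rewrite /E scalerA.
  rewrite affine_move // affine_move // (lQ v vQ) add0r.
  rewrite big1_seq => [|q /= qC]; last by rewrite lC // subrr mulr0.
  rewrite add0r; have lz i1 : a i1 * la (z i1) * (l (z i1) - 0) =
      (i1 == j')%:R *: (a i1 : R^o) - (i1 == j)%:R *: (a i1 : R^o).
    rewrite subr0 lF // !zeq mulrBr; congr (_ - _).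
      case: (i1 =P j') => [->|_]; last by rewrite mul0r mulr0 scale0r.
      by rewrite scale1r mul1r mulfK // gt_eqF // la0.
    case: (i1 =P j) => [->|_]; last by rewrite mul0r mulr0 scale0r.
    by rewrite scale1r mul1r mulfK // gt_eqF // la0.
  under eq_bigr do rewrite lz.
  rewrite sumrB (bigD1 j') //= eqxx scale1r big1 => [|i1 /negPf ->]; last by rewrite scale0r.
  rewrite (bigD1 j) //= eqxx scale1r big1 => [|i1 /negPf ->]; last by rewrite scale0r.
  by rewrite !addr0 ajj' subrr.
Qed.

(** By induction on [F]: the cells over each facet of [F] are known to carry one
    jet, and [star_step] compares these jets. *)
Lemma flag_jets F C : flag T F C -> v \in (c F |` C)%fset ->
  (forall A, pcell k c F A -> Delta (A `|` C)%fset) ->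
  forall D, (D <= r + (k - 1) * (r.+1)./2)%N ->
  forall A A', pcell k c F A -> pcell k c F A' ->
    forall w, size w = D -> J (A `|` C)%fset w = J (A' `|` C)%fset w.
Proof.
have [m] := ubnP #|` F|; elim: m F C => // m IH F C Fm fl vcC DF D DD.
move=> A A' cA cA' w wD.
have [kF|kF] := ltnP k #|` F|; last first.
  have e : #|` F| = k by apply/eqP; rewrite eqn_leq kF (pcell_card cA).
  by rewrite (pcell_baseP e cA) (pcell_baseP e cA').
apply: (star_step fl kF vcC DF DD) => // x B B' xF cB cB' w' wD'.
apply: (IH (F `\ x)%fset) cB cB' w' wD' => //.
- by move: Fm; rewrite (card_fsetD1 xF).
- exact: (flag_step T_simplex c_int).
- by rewrite inE vcC orbT.
- by move=> B1 cB1; have := DF _ (pcell_step kF xF cB1); rewrite fsetUCA fsetUA.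
Qed.

End Lower.

(** * A spline of limited smoothness *)

Section Upper.
Context {R : realType} {n : nat}.
Local Notation V := 'rV[R]_n.
Implicit Types (T F S C P Q A B : {fset V}) (x y u v : V).
Variables (k : nat) (c : {fset V} -> V) (T : {fset V}).
Hypothesis T_simplex : is_simplex n T.
Hypothesis c_int : forall F, (F `<=` T)%fset -> (k < #|` F|)%N -> rel_interior F (c F).
Hypothesis n_gt0 : (0 < n)%N.
Hypothesis k_gt0 : (0 < k)%N.
Hypothesis k_le : (k <= n)%N.
Variable r : nat.

Lemma affine_polyfun (l : V -> R) : affine_fun l -> polyfun l.
Proof.
move=> [g [h hl]].
have -> : l = (fun y => \sum_j y 0 j * g j 0 + h) by apply/funext => y; rewrite hl mxE.
apply: polyfunD; last exact: polyfun_cst.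
by apply: polyfun_sum => j; apply: polyfunM; [exact: polyfun_coord|exact: polyfun_cst].
Qed.

Lemma expo0_sum : (\sum_(l < n.+1) expo r.+1 0 l).+1 = (rho n r).+1.
Proof.
rewrite (expo_sum _ ord0) // /rho divn2; case: (n) n_gt0 => // n' _.
rewrite subn1 /= addn0; have [ro|ro] := boolP (odd r) => /=.
  have : (r = uphalf r * 2 - 1)%N by lia.
  by case: (uphalf r) => [|h] h1; nia.
have : (r = uphalf r * 2)%N by lia.
by nia.
Qed.

(** On the cone over the facet opposite to the vertex [z i] the coordinate [xi i]
    is the least one, and the piece there is the first integral evaluated at
    [xi i]. The pieces are homogeneous about the centre, of degree
    [rho n r + 1]: if their derivatives of that order agreed at the centre, they
    would coincide everywhere, which the independence of the integrals forbids. *)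
Lemma rough_spline : exists2 sigma, spline_smooth r (split_cells k c T) sigma &
  forall q, spline_smooth_at q (split_cells k c T) (c T) sigma -> (q <= rho n r)%N.
Proof.
have kT : (k < #|` T|)%N by rewrite T_simplex.1.
have [la [la0 la1 cE]] := c_weights T_simplex c_int (fsubset_refl T) kT.
have [b [ab b1 bE]] := bary_exists T_simplex.
have bv := bary_vertex T_simplex.2 b1 bE.
set v := c T in cE *.
pose z (i : 'I_n.+1) : V := nth 0 T i.
have szT : size T = n.+1 by rewrite -T_simplex.1.
have zT i : z i \in T by rewrite mem_nth // szT.
have zeq i j : (z i == z j) = (i == j) by rewrite /z nth_uniq ?fset_uniq ?szT.
have sumT (W : nmodType) (g : V -> W) : \sum_(x <- T) g x = \sum_i g (z i).
  by rewrite (big_nth 0) szT big_mkord.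
pose xi (i : 'I_n.+1) y : R := b (z i) y / la (z i) - 1.
have axi i : affine_fun (xi i).
  have -> : xi i = (fun y => (la (z i))^-1 * b (z i) y + -1 * 1).
    by apply/funext => y; rewrite /xi mulr1 mulrC.
  by apply: affine_lin => //; apply: affine_cst.
have pxi i := affine_polyfun (axi i).
have xiv i : xi i v = 0.
  rewrite /xi; have -> : b (z i) v = la (z i).
    by apply: (@aff_unique _ _ T (b^~ v) la) => //; [exact: T_simplex.2|rewrite b1|rewrite -bE].
  by rewrite divff ?subrr // gt_eqF // la0.
pose e (l : 'I_n.+1) : nat := expo r.+1 0 l.
pose piece i := theta_fun xi e i.
have piece_smooth i : smooth_on setT (piece i) by apply/polyfun_smooth/polyfun_theta.
pose low (S : {fset V}) := [set i | forall s, s \in S -> forall l, xi i s <= xi l s].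
(* A cell lies in the cone where one coordinate is the least; [idx] recovers it. *)
pose idx S := xget ord0 (low S).
pose sigma S : set V * (V -> R) := (setT, piece (idx S)).
have cell_low i A : pcell k c (T `\ z i)%fset A -> low (v |` A)%fset i.
  move=> cA s; rewrite !inE => /predU1P[->|sA] l; first by rewrite !xiv.
  have := pcell_conv c_int (fsubD1set _ _) cA sA.
  move=> [w [w0 w1 ->]]; rewrite /xi lerD2r !affine_comb //.
  rewrite [X in X / _]big1_seq ?mul0r => [|x /= xT]; last first.
    move: xT; rewrite !inE => /andP[/negPf xi0 xT].
    by rewrite bv // eq_sym xi0 mulr0.
  rewrite divr_ge0 //; last by rewrite ltW // la0.
  rewrite big_seq sumr_ge0 // => x xT; rewrite mulr_ge0 ?w0 //.
  by move: xT; rewrite !inE => /andP[_ xT]; rewrite bv // ler0n.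
have idxP S : split_cells k c T S -> low S (idx S).
  move=> /(split_pcell c S kT)/(pcell_stepP kT)[x [A [xT cA ->]]].
  have [i ix] : exists i, z i = x.
    have lt : (index x T < n.+1)%N by rewrite -szT index_mem.
    by exists (Ordinal lt); rewrite /z /= nth_index.
  apply: (xgetPex ord0); exists i; apply: cell_low.
  by rewrite ix.
have low_conv S i y : low S i -> conv_hull S y -> forall l, xi i y <= xi l y.
  move=> li [w [w0 w1 ->]] l; rewrite !affine_comb //.
  rewrite big_seq [leRHS]big_seq; apply: ler_sum => s sS.
  by apply: ler_wpM2l; [exact: w0|exact: li].
exists sigma.
  split=> [S DS|S S' DS DS' _ _ a ar x [xS xS']].
    by split; [exact: openT|move=> ? _|exact: piece_smooth].
  rewrite /sigma /=; have [->//|ne] := eqVneq (idx S) (idx S').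
  apply/eqP; rewrite -subr_eq0 /mi_derive -(pderivesB openT) //.
  apply/eqP; apply: (@theta_fun_vanish _ _ _ xi e pxi); first by rewrite eq_sym.
    by apply/eqP; rewrite eq_le (low_conv _ _ _ (idxP _ DS') xS')
      (low_conv _ _ _ (idxP _ DS) xS).
  rewrite mi_word; apply: leq_ltn_trans ar _.
  by rewrite (@expo_pair r.+1) // eq_sym.
move=> q [_ hq]; rewrite leqNgt; apply/negP => qn.
have cells i : exists2 S, split_cells k c T S & idx S = i.
  have [|A cA] := @pcell_exists _ _ k c (T `\ z i)%fset k_gt0.
    by rewrite -ltnS -(card_fsetD1 (zT i)).
  pose S := (v |` A)%fset.
  have cS : pcell k c T S by apply: pcell_step cA.
  have DS : split_cells k c T S by apply/(split_pcell c S kT).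
  exists S => //; apply/eqP/negPn/negP => ne.
  have fl : flag T T fset0 by split; rewrite ?fsetU0 ?cardfs0 ?addn0 ?T_simplex.1.
  have := flag_cell T_simplex c_int fl cS; rewrite fsetU0 => sS.
  have [b' [_ b'1 b'E]] := bary_exists sS.
  have eqS s : s \in S -> xi (idx S) s = xi i s.
    by move=> sS'; apply/eqP; rewrite eq_le (idxP _ DS) // (cell_low _ _ cA).
  have : xi (idx S) (z i) = xi i (z i).
    rewrite [z i](b'E (z i)) !affine_comb //.
    by apply: eq_big_seq => s sS'; rewrite eqS.
  rewrite /xi !bv // eqxx zeq (negPf ne) mul0r mul1r => /addIr /esym /eqP.
  by rewrite invr_eq0 gt_eqF // la0.
have jets i i' w : size w = (rho n r).+1 -> jet (piece i) v w = jet (piece i') v w.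
  have [S DS <-] := cells i; have [S' DS' <-] := cells i'.
  move=> sw; have /= := hq S S' DS DS' (mi_of w); rewrite mi_of_order sw => /(_ qn).
  by rewrite !(mi_derive_jet w openT).
have xi_dir l u s : xi l (v + s *: u) = s * xi l (v + u).
  have [g [h hl]] := axi l; have := xiv l; rewrite !hl !mulmxDl -scalemxAl.
  move: (v *m g) (u *m g) => pv pu h0.
  have -> : h = - pv 0 0 by apply/eqP; rewrite -addr_eq0 addrC h0.
  by rewrite !mxE; ring.
have homog i u s : piece i (v + s *: u) = s ^+ (rho n r).+1 * piece i (v + u).
  rewrite /piece !theta_funE !xi_dir -expo0_sum exprS.
  under eq_bigr do rewrite xi_dir -scalerA polyCM mul_polyC -scalerBr exprZn.
  rewrite scaler_prod prodrXr int01Z.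
  by rewrite -!mulrA; congr (_ * _); rewrite mulrCA.
have same i i' u : piece i (v + u) = piece i' (v + u).
  have := @eq_iter_jshift _ _ u _ _ (rho n r).+1 [::]
    (fun w' hw => @jets i i' w' (etrans hw (addn0 _))).
  rewrite !(homogeneous_jet _ (homog _ _)) // => /mulfI; apply.
  by rewrite pnatr_eq0 -lt0n fact_gt0.
(* At a point with pairwise distinct coordinates the pieces cannot all agree. *)
pose m : R := \sum_(l < n.+1) la (z l) * l%:R.
pose t (l : 'I_n.+1) : R := l%:R - m.
pose w x := la x * (1 + (index x T)%:R - m).
have wz l : w (z l) = la (z l) * (1 + t l).
  by rewrite /w /t /z index_uniq ?fset_uniq ?szT // addrA.
have laz1 : \sum_l la (z l) = 1 by rewrite -sumT.
have w1 : \sum_(x <- T) w x = 1.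
  rewrite sumT; under eq_bigr do rewrite wz mulrDr mulr1 /t mulrBr.
  by rewrite big_split /= sumrB -mulr_suml laz1 mul1r subrr addr0.
pose y := \sum_(x <- T) w x *: x.
have xiy l : xi l y = t l.
  rewrite /xi (_ : b (z l) y = w (z l)); last first.
    by apply: (@aff_unique _ _ T (b^~ y) w T_simplex.2) => //; rewrite ?b1 ?w1 -?bE.
  by rewrite wz mulrC mulKf ?gt_eqF ?la0 // addrC addKr.
have t_inj : injective t.
  by move=> i j /addIr /eqP; rewrite eqr_nat => /eqP; apply: val_inj.
have := @theta_free R n t (fun (s : 'I_n) (l : 'I_n.+1) => expo r.+1 s l)
  (fun l : 'I_n.+1 => expo_min r.+1 n l) (- piece ord0 y)
  (fun s : 'I_n => (s == Ordinal n_gt0)%:R) t_inj.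
move=> /(_ _ _ _ _ (Ordinal n_gt0)); rewrite eqxx => H.
have : (1 : R) = 0.
  apply: H.
  - by move=> s l; apply: expo_min_le.
  - by move=> s; apply: expo_deg.
  - by move=> s s' ss; apply: expo_tri.
  move=> i; rewrite (bigD1 (Ordinal n_gt0)) //= ?eqxx mul1r big1 => [|s /negPf ->]; last first.
    by rewrite mul0r.
  rewrite addr0; apply/eqP; rewrite addrC subr_eq0; apply/eqP.
  have <- : piece i y = piece ord0 y by rewrite -[y](subrK v) addrC; apply: same.
  rewrite /piece /theta_fun xiy; congr (prim _ (nodal _ _)).[_].
  by apply/funext => l; rewrite xiy.
by move/eqP; rewrite oner_eq0.
Qed.

End Upper.

Theorem theorem4 (R : realType) (k n r : nat)
    (Delta : set {fset 'rV[R]_n}) (v : 'rV[R]_n) :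
  (2 <= k)%N -> (k <= n)%N ->
  is_Delta k Delta v ->
  exists m : nat, is_mos r Delta v m /\ (rho k r <= m)%N /\ (m <= rho n r)%N.
Proof.
move=> k2 kn [T [c [sT c_int -> ->]]].
have k0 : (0 < k)%N by apply: leq_trans k2.
have n0 : (0 < n)%N by apply: leq_trans kn.
have kT : (k < #|` T|)%N by rewrite sT.1.
set Delta0 := split_cells k c T; set v0 := c T.
pose good q := `[< spline_smooth r Delta0 `<=` spline_smooth_at q Delta0 v0 >].
have good_rho : good (rho k r).
  apply/asboolP => sigma hs; split=> [|S S' DS DS' a ar]; first exact: hs.1.
  have fl : flag T T fset0.
    by split; rewrite ?fsetU0 ?cardfs0 ?addn0 ?sT.1.
  have vT : v0 \in (c T |` fset0)%fset by rewrite !inE eqxx.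
  have DT A : pcell k c T A -> Delta0 (A `|` fset0)%fset.
    by rewrite fsetU0 => cA; apply/(split_pcell c A kT).
  have ar' : (mi_order a <= r + (k - 1) * (r.+1)./2)%N by move: ar; rewrite /rho divn2.
  have := @flag_jets R n k c T sT c_int r Delta0 v0 sigma n0 k0 hs T fset0 fl vT DT _ ar' S S'.
  rewrite !fsetU0; apply; last exact: mi_word.
    exact/(split_pcell c S kT).
  exact/(split_pcell c S' kT).
have good_le q : good q -> (q <= rho n r)%N.
  move=> /asboolP hq; have [sigma hs hle] := rough_spline sT c_int n0 k0 kn r.
  exact/hle/hq.
(* Agreement to order [rho k r] holds and agreement beyond [rho n r] fails, so
   there is a largest order. *)
have [m gm mmax] := ex_maxnP (ex_intro good _ good_rho) good_le.
exists m; split; last by split; [exact: mmax|exact: good_le].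
have rk : (r <= rho k r)%N by rewrite /rho leq_addr.
split=> [|q [_ hq]]; last by apply: mmax; apply/asboolP.
by split; [apply: leq_trans rk (mmax _ good_rho)|apply/asboolP].
Qed.
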